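(* Let $k$ be a field. Let $\Delta\subseteq\mathbb{R}^n$ be a (bounded) convex lattice polytope of dimension greater than one and let $\Delta'\subseteq\mathbb{R}^n$ be convex. Put $S=\Delta'\cap\mathbb{Z}^n$, $T=\Delta\cap\mathbb{Z}^n$, $p=\#T-1$ and $X=\{P\in\mathbb{Z}^n\mid P+T\subseteq S\}$. Then the elements $x_{P_1,\ldots,P_p}$, for all sequences $(P_1,\dots,P_p)$ of points of $X$, form a basis of $\bigcap_{i=1}^p\ker\delta_i$; and hence the elements $x_A$, for all monomials $A$ of degree $p$ with variables in $X$, form a basis of $\ker\delta$.
   Context: For a set $B\subseteq\mathbb{Z}^n$ let $V_B$ be the $k$-vector space with basis $B$; a lattice point is also written for the corresponding basis vector, and sums of lattice points inside a tensor slot are taken in $\mathbb{Z}^n$. $S+T=\{s+t\mid s\in S,t\in T\}$. A lattice polytope is the convex hull of finitely many points of $\mathbb{Z}^n$. Maps: $\delta:\bigwedge^pV_S\otimes V_T\to\bigwedge^{p-1}V_S\otimes V_{S+T}$, $P_1\wedge\dots\wedge P_p\otimes Q\mapsto\sum_{i=1}^p(-1)^iP_1\wedge\dots\wedge\widehat{P_i}\wedge\dots\wedge P_p\otimes(Q+P_i)$. For $1\le i\le p$, $\delta_i:V_S^{\otimes p}\otimes V_T\to V_S^{\otimes(p-1)}\otimes V_{S+T}$, $P_1\otimes\dots\otimes P_p\otimes Q\mapsto P_1\otimes\dots\otimes\widehat{P_i}\otimes\dots\otimes P_p\otimes(P_i+Q)$. Fix a list $Q_1,\dots,Q_{p+1}$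 of all points of $T$. For $P_1,\dots,P_p\in X$, $$x_{P_1,\dots,P_p}=\sum_{\sigma\in S_{p+1}}\mathrm{sgn}(\sigma)(P_1+Q_{\sigma(1)})\otimes\dots\otimes(P_p+Q_{\sigma(p)})\otimes Q_{\sigma(p+1)},$$ where $S_{p+1}$ is the symmetric group. Regard the elements of $X$ as variables. For a monomial $A=\prod_{P\in X}P^{a_P}$ of degree $p$, let $P_1,\dots,P_p$ be a list of points of $X$ in which each $P$ occurs $a_P$ times, and define $$x_A=\prod_{P}\frac1{a_P!}\sum_{\sigma\in S_{p+1}}\mathrm{sgn}(\sigma)(P_1+Q_{\sigma(1)})\wedge\dots\wedge(P_p+Q_{\sigma(p)})\otimes Q_{\sigma(p+1)}\in\bigwedge^pV_S\otimes V_T.$$ Terms for $\sigma,\sigma'$ with $\sigma(\{i\mid P_i=P\})=\sigma'(\{i\mid P_i=P\})$ for all $P$ are equal, and each such equivalence class has $\prod_Pa_P!$ elements; over an arbitrary field $x_A$ is understood as the sum over one representative $\sigma$ of each equivalence class. Up to sign $x_A$ does not depend on the chosen lists. *)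

(* Defs.v *)
From HB Require Import structures.
From mathcomp Require Import all_boot all_order all_algebra all_fingroup.
From mathcomp Require Import finmap generic_quotient ring_quotient.
From mathcomp Require Import boolp classical_sets reals convex.
From mathcomp Require Import monalg freeg.
Set Implicit Arguments.
Unset Strict Implicit.
Unset Printing Implicit Defensive.
Import GRing.Theory.
Local Notation lift := fintype.lift.
Local Open Scope classical_set_scope.
Local Open Scope ring_scope.
Local Open Scope quotient_scope.

Section Span.
Variables (k : fieldType) (V : lmodType k) (G : set V).

Definition spanp : {pred V} := fun v =>
  `[< exists s : seq (k * V), (forall x, x \in s -> G x.2) /\
        v = \sum_(x <- s) x.1 *: x.2 >].

Lemma spanpP v : reflect (exists s : seq (k * V),
  (forall x, x \in s -> G x.2) /\ v = \sum_(x <- s) x.1 *: x.2) (v \in spanp).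
Proof. exact: asboolP. Qed.

Lemma spanpZ a v : v \in spanp -> a *: v \in spanp.
Proof.
move=> /spanpP[s [Gs ->]]; apply/spanpP.
exists [seq (a * x.1, x.2) | x <- s]; split.
  by move=> _ /mapP[x xs ->]; exact: (Gs x).
by rewrite big_map scaler_sumr; apply: eq_bigr => x _; rewrite scalerA.
Qed.

Lemma spanpD v w : v \in spanp -> w \in spanp -> v + w \in spanp.
Proof.
move=> /spanpP[s [Gs ->]] /spanpP[t [Gt ->]]; apply/spanpP.
exists (s ++ t); split; last by rewrite big_cat.
by move=> x; rewrite mem_cat => /orP[]; [exact: Gs | exact: Gt].
Qed.

Lemma spanp0 : 0 \in spanp.
Proof. by apply/spanpP; exists [::]; split => //; rewrite big_nil. Qed.

Lemma spanp_gen v : G v -> v \in spanp.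
Proof.
move=> Gv; apply/spanpP; exists [:: (1, v)]; split.
  by move=> x; rewrite inE => /eqP ->.
by rewrite big_seq1 scale1r.
Qed.

Lemma spanp_closed : zmod_closed spanp.
Proof.
split; first exact: spanp0.
by move=> v w vG wG; rewrite -scaleN1r; apply: spanpD => //; exact: spanpZ.
Qed.

HB.instance Definition _ := GRing.isZmodClosed.Build V spanp spanp_closed.

(* the quotient vector space V / span G *)
Definition quotspan := Quotient.quot spanp.
HB.instance Definition _ := ZmodQuotient.on quotspan.

Definition qscale (a : k) (x : quotspan) : quotspan :=
  \pi_quotspan (a *: repr x).

Lemma qeqP (v w : V) :
  reflect (\pi_quotspan v = \pi_quotspan w) (v - w \in spanp).
Proof. by rewrite Quotient.idealrBE; exact: eqP. Qed.

Lemma pi_qscale a v : \pi_quotspan (a *: v) = qscale a (\pi_quotspan v).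
Proof.
apply/qeqP; rewrite -scalerBr; apply: spanpZ; apply/qeqP.
by rewrite reprK.
Qed.

Lemma piD (v w : V) :
  \pi_quotspan (v + w) = \pi_quotspan v + \pi_quotspan w.
Proof. exact: pi_addr. Qed.

Lemma qscaleA a b x : qscale a (qscale b x) = qscale (a * b) x.
Proof. by elim/quotW: x => v; rewrite -(pi_qscale b) -!(pi_qscale _ (b *: v)) -pi_qscale scalerA. Qed.

Lemma qscale1 : left_id 1 qscale.
Proof. by elim/quotW => v; rewrite -(pi_qscale 1 v) scale1r. Qed.

Lemma qscaleDr : right_distributive qscale +%R.
Proof.
move=> a; elim/quotW => v; elim/quotW => w.
by rewrite -piD -(pi_qscale a v) -(pi_qscale a w) -(pi_qscale a (v + w)) -piD scalerDr.
Qed.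

Lemma qscaleDl x : {morph qscale^~ x : a b / a + b}.
Proof.
by elim/quotW: x => v a b; rewrite -!(pi_qscale _ v) -piD scalerDl.
Qed.

HB.instance Definition _ := GRing.Zmodule_isLmodule.Build k quotspan
  qscaleA qscale1 qscaleDr qscaleDl.

Definition qproj (v : V) : quotspan := \pi_quotspan v.

Lemma qproj_is_linear : linear qproj.
Proof. by move=> a v w; rewrite /qproj piD pi_qscale. Qed.
HB.instance Definition _ :=
  GRing.isLinear.Build k V quotspan *:%R qproj qproj_is_linear.

Lemma qproj_eq0 v : (qproj v = 0) <-> (v \in spanp).
Proof.
rewrite -[0](raddf0 qproj) -{2}[v]subr0.
by split => [/qeqP|vG]; last exact/qeqP.
Qed.

End Span.

Definition lin_indep (k : fieldType) (V : lmodType k) (I : choiceType)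
    (b : I -> V) : Prop :=
  forall (s : seq I) (c : I -> k), uniq s ->
    \sum_(i <- s) c i *: b i = 0 -> forall i, i \in s -> c i = 0.

Definition is_basis (k : fieldType) (V : lmodType k) (I : choiceType)
    (b : I -> V) (K : set V) : Prop :=
  lin_indep b /\ [set v | v \in spanp (range b)] = K.

Section Polytopes.
Variables (R : realType) (n : nat).

Definition toR (P : 'rV[int]_n) : 'rV[R]_n := map_mx intr P.

Definition lattice_points (D : set 'rV[R]_n) : set 'rV[int]_n :=
  [set P | D (toR P)].

Definition convex (D : set 'rV[R]_n) : Prop :=
  convex_set (D : set (convex_lmodType 'rV[R]_n)).

Definition lattice_polytope (D : set 'rV[R]_n) : Prop :=
  exists s : seq 'rV[int]_n, D = smallest convex [set toR P | P in [set` s]].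

Definition affine_subspace (d : nat) (A : set 'rV[R]_n) : Prop :=
  exists (a : 'rV[R]_n) (U : {vspace 'rV[R]_n}),
    A = [set a + u | u in [set u | u \in U]] /\ \dim U = d.

Definition affine_hull : set 'rV[R]_n -> set 'rV[R]_n :=
  smallest [set A | exists d, affine_subspace d A].

Definition has_dim (D : set 'rV[R]_n) (d : nat) : Prop :=
  affine_subspace d (affine_hull D).

End Polytopes.

Section PointSets.
Variable n : nat.
Implicit Types S T : set 'rV[int]_n.

Definition sumset S T : set 'rV[int]_n := [set s + t | s in S & t in T].

Definition translates S T : set 'rV[int]_n :=
  [set P | sumset [set P] T `<=` S].

Lemma padd_subproof S T (P : S) (Q : T) : val P + val Q \in sumset S T.
Proof.
apply/mem_set; exists (val P); first exact: set_valP.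
by exists (val Q); first exact: set_valP.
Qed.

Definition padd S T (P : S) (Q : T) : sumset S T :=
  exist _ (val P + val Q) (padd_subproof P Q).

Lemma tadd_subproof S T (P : translates S T) (Q : T) : val P + val Q \in S.
Proof.
apply/mem_set; apply: (set_valP P); exists (val P) => //.
by exists (val Q) => //; exact: set_valP.
Qed.

Definition tadd S T (P : translates S T) (Q : T) : S :=
  exist _ (val P + val Q) (tadd_subproof P Q).

End PointSets.

(* V_S^{(x)p} (x) V_T, through its basis of pure tensors of lattice points *)
Notation tens k p S T :=
  {freeg ({ffun 'I_p -> set_type S} * set_type T)%type / k}.

Section Koszul.
Variables (k : fieldType) (n : nat).
Implicit Types (p : nat) (S T : set 'rV[int]_n).

Definition pure p S T (P : {ffun 'I_p -> S}) (Q : T) : tens k p S T :=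
  [freeg [:: (1, (P, Q))]].

Definition omit p S (i : 'I_p) (P : {ffun 'I_p -> S}) : {ffun 'I_p.-1 -> S} :=
  [ffun j => P (lift i j)].

Definition delta_at p S T (i : 'I_p) :
    tens k p S T -> tens k p.-1 S (sumset S T) :=
  fglift (fun PQ => pure (omit i PQ.1) (padd (PQ.1 i) PQ.2)).

(* /\^p V_S (x) V_T is V_S^{(x)p} (x) V_T modulo the tensors with two equal
   factors in V_S; on the basis of pure tensors of lattice points this subspace
   is spanned by the elements below: for v = sum_i c_i e_i, the tensor v (x) v
   is sum_i c_i^2 e_i (x) e_i + sum_(i < j) c_i c_j (e_i (x) e_j + e_j (x) e_i),
   in any two slots. *)
Definition alt_rel p S T : set (tens k p S T) :=
  [set v | (exists (P : {ffun 'I_p -> S}) (Q : T),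
              ~ injective P /\ v = pure P Q) \/
           (exists (P : {ffun 'I_p -> S}) (Q : T) (s : 'S_p),
              v = pure [ffun i => P (s i)] Q - (-1) ^+ s *: pure P Q)].

Definition ext p S T := quotspan (@alt_rel p S T).
HB.instance Definition _ p S T := GRing.Lmodule.on (ext p S T).

Definition wedge p S T (P : {ffun 'I_p -> S}) (Q : T) : ext p S T :=
  qproj (@alt_rel p S T) (pure P Q).

(* indices run over 0, ..., p-1, whence the shift in the sign *)
Definition delta_tens p S T :
    tens k p S T -> tens k p.-1 S (sumset S T) :=
  fglift (fun PQ => \sum_(i < p)
    (-1) ^+ i.+1 *: pure (omit i PQ.1) (padd (PQ.1 i) PQ.2)).

Definition delta p S T (x : ext p S T) : ext p.-1 S (sumset S T) :=
  qproj (@alt_rel p.-1 S (sumset S T)) (delta_tens (repr x)).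

Lemma fglift_is_linear (V : lmodType k) (K : choiceType) (f : K -> V) :
  linear (fglift f).
Proof.
pose g := GRing.isZmodMorphism.Build _ _ (fglift f) (lift_is_additive f).
pose F : {additive {freeg K / k} -> V} := HB.pack (fglift f) g.
have FU c z : F [freeg [:: (c, z)]] = c *: f z by exact: liftU.
have FE (s : seq K) (c : K -> k) :
    F (\sum_(z <- s) [freeg [:: (c z, z)]]) = \sum_(z <- s) c z *: f z.
  by rewrite raddf_sum; apply: eq_bigr => z _; rewrite FU.
move=> a x y; change (F (a *: x + y) = a *: F x + F y).
rewrite raddfD; congr (_ + _).
have -> : F x = \sum_(z <- dom x) coeff z x *: f z.
  by rewrite -FE freeg_sumE.
have -> : a *: x = \sum_(z <- dom x) [freeg [:: (a * coeff z x, z)]].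
  have cE (c : K -> k) t : coeff t (\sum_(z <- dom x) [freeg [:: (c z, z)]]) =
      \sum_(z <- dom x) c z * (z == t)%:R.
    by rewrite raddf_sum; apply: eq_bigr => z _; exact: coeffU.
  apply/eqP/freeg_eqP => t; rewrite [RHS]cE coeffZ -[in LHS](freeg_sumE x).
  rewrite [in LHS]cE mulr_sumr.
  by apply: eq_bigr => z _; rewrite mulrA.
by rewrite FE scaler_sumr; apply: eq_bigr => z _; rewrite scalerA.
Qed.
HB.instance Definition _ (V : lmodType k) (K : choiceType) (f : K -> V) :=
  GRing.isLinear.Build k {freeg K / k} V *:%R (fglift f) (fglift_is_linear f).

Lemma fglift_pure p S T (V : lmodType k)
    (f : {ffun 'I_p -> S} * T -> V) P Q : fglift f (pure P Q) = f (P, Q).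
Proof. by rewrite liftU scale1r. Qed.

Lemma wedge_perm p S T (P : {ffun 'I_p -> S}) (Q : T) (s : 'S_p) :
  wedge [ffun i => P (s i)] Q = (-1) ^+ s *: wedge P Q.
Proof.
rewrite /wedge -linearZ; apply/subr0_eq; rewrite -linearB; apply/qproj_eq0.
by apply: spanp_gen; right; exists P, Q, s.
Qed.

Lemma wedge_eq0 p S T (P : {ffun 'I_p -> S}) (Q : T) :
  ~ injective P -> wedge P Q = 0.
Proof. by move=> Pinj; apply/qproj_eq0/spanp_gen; left; exists P, Q. Qed.

Lemma omit_perm q (s : 'S_q.+1) (i : 'I_q.+1) : exists t : 'S_q,
  (forall j, s (lift i j) = lift (s i) (t j)) /\
  (-1) ^+ s * (-1) ^+ (s i).+1 = (-1) ^+ i.+1 * (-1) ^+ t :> k.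
Proof.
pose ulsf (i0 : 'I_q.+1) (s0 : 'S_q.+1) j :=
  odflt j (unlift (s0 i0) (s0 (lift i0 j))).
have ulsfK i0 (s0 : 'S_q.+1) j : lift (s0 i0) (ulsf i0 s0 j) = s0 (lift i0 j).
  rewrite /ulsf; have := neq_lift i0 j.
  by rewrite -(can_eq (permK s0)) => /unlift_some[] ? ? ->.
have inj_ulsf : injective (ulsf i s).
  apply: can_inj (ulsf (s i) s^-1%g) _ => j.
  by rewrite {1}/ulsf ulsfK !permK liftK.
exists (perm inj_ulsf); split=> [j|]; first by rewrite permE ulsfK.
have sE : s = lift_perm i (s i) (perm inj_ulsf).
  apply/permP => j; case: (unliftP i j) => [j'|] ->; rewrite ?lift_perm_id //.
  by rewrite lift_perm_lift permE ulsfK.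
have := odd_lift_perm i (s i) (perm inj_ulsf); rewrite -sE => ->.
rewrite -(signr_odd _ (s i).+1) -(signr_odd _ i.+1) /= -!signr_addb.
by congr (_ ^+ nat_of_bool _); case: odd; case: odd; case: odd_perm.
Qed.

(* the formula defining delta on the generators, and its compatibility with
   the relations of the exterior power *)
Lemma delta_qproj p S T (v : tens k p S T) :
  delta (qproj (@alt_rel p S T) v) =
  qproj (@alt_rel p.-1 S (sumset S T)) (delta_tens v).
Proof.
have dE (P : {ffun 'I_p -> S}) (Q : T) : qproj (@alt_rel _ _ _)
      (delta_tens (pure P Q)) =
    \sum_(i < p) (-1) ^+ i.+1 *: wedge (omit i P) (padd (P i) Q).
  rewrite /delta_tens fglift_pure /= linear_sum.
  by apply: eq_bigr => i _; rewrite linearZ.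
suff rel0 (w : tens k p S T) : alt_rel w -> qproj (@alt_rel _ _ _) (delta_tens w) = 0.
  rewrite /delta; apply/subr0_eq; rewrite -linearB /delta_tens -linearB.
  have /qeqP/spanpP[s [Gs ->]] : \pi_(quotspan (@alt_rel p S T))
      (repr (qproj (@alt_rel p S T) v)) = \pi_(quotspan (@alt_rel p S T)) v.
    by rewrite reprK.
  rewrite !linear_sum big_seq big1 // => x xs; rewrite !linearZ.
  by rewrite /= (rel0 _ (Gs x xs)) scaler0.
clear v; case: p w dE => [|q] w dE.
  case=> [[P [Q [nP _]]]|[P [Q [s ->]]]]; first by case: nP; case.
  rewrite /delta_tens !linearB !linearZ /= -/(delta_tens _) !dE !big_ord0.
  by rewrite scalerN scaler0 subrr.
have omitE (P : {ffun 'I_q.+1 -> S}) (s : 'S_q.+1) (i : 'I_q.+1) (Q : sumset S T) :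
    (-1) ^+ s * (-1) ^+ (s i).+1 *: wedge (omit (s i) P) Q =
    (-1) ^+ i.+1 *: wedge (omit i [ffun j => P (s j)]) Q.
  have [t [st ->]] := omit_perm s i; rewrite -scalerA -wedge_perm.
  by congr (_ *: wedge _ _); apply/ffunP => j; rewrite !ffunE st.
case=> [[P [Q [nP ->]]]|[P [Q [s ->]]]]; last first.
  rewrite /delta_tens !linearB !linearZ /= -!/(delta_tens _) !dE.
  rewrite scalerN [in X in _ - X](reindex_inj (@perm_inj _ s)).
  rewrite scaler_sumr /=.
  apply/eqP; rewrite subr_eq0; apply/eqP; apply: eq_bigr => i _.
  by rewrite ffunE -omitE scalerA.
rewrite dE.
have [a [b [ab Pab]]] : exists a b, a != b /\ P a = P b.
  apply: contrapT => nab; apply: nP => a b Pab; apply/eqP/negPn/negP => ab.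
  by apply: nab; exists a, b.
rewrite (bigD1 a) //= (bigD1 b) 1?eq_sym //= big1 ?addr0; last first.
  move=> i /andP[ia ib]; rewrite wedge_eq0 ?scaler0 // => inj.
  have /unlift_some[a' a'E _] := ia; have /unlift_some[b' b'E _] := ib.
  move: ab; rewrite a'E b'E (inj a' b') ?eqxx //.
  by rewrite !ffunE -a'E -b'E.
have := omitE P (tperm a b) a (padd (P b) Q).
rewrite tpermL odd_tperm ab expr1 mulN1r scaleNr.
have -> : [ffun j => P (tperm a b j)] = P.
  by apply/ffunP => j; rewrite ffunE; case: tpermP => [->|->|].
by rewrite Pab => <-; rewrite addNr.
Qed.

Lemma delta_wedge p S T (P : {ffun 'I_p -> S}) (Q : T) :
  delta (wedge P Q) =
  \sum_(i < p) (-1) ^+ i.+1 *: wedge (omit i P) (padd (P i) Q).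
Proof.
rewrite /wedge delta_qproj /delta_tens fglift_pure /= linear_sum.
by apply: eq_bigr => i _; rewrite linearZ.
Qed.

Lemma delta_is_linear p S T : linear (@delta p S T).
Proof.
move=> a x y; have E z : z = qproj (@alt_rel p S T) (repr z).
  by rewrite /qproj reprK.
rewrite (E x) (E y) -linearP !delta_qproj -linearP.
by congr qproj; exact: linearP.
Qed.
HB.instance Definition _ p S T :=
  GRing.isLinear.Build k (ext p S T) (ext p.-1 S (sumset S T)) *:%R
    (@delta p S T) (@delta_is_linear p S T).

Section Elements.
Variables (p : nat) (S T : set 'rV[int]_n).
(* Q is the list of points of T and P a list of points of X *)
Variables (Q : 'I_p.+1 -> T) (P : {ffun 'I_p -> translates S T}).
Implicit Types s : 'S_p.+1.

Definition initial (i : 'I_p) : 'I_p.+1 := widen_ord (leqnSn p) i.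

Definition shifted s : {ffun 'I_p -> S} :=
  [ffun i => tadd (P i) (Q (s (initial i)))].

Definition x_tens : tens k p S T :=
  \sum_(s : 'S_p.+1) (-1) ^+ s *: pure (shifted s) (Q (s ord_max)).

(* a point of X outside the list P gives the condition set0 = set0, so only the
   conditions for the points P i0 are stated *)
Definition same_blocks s s' : bool :=
  [forall i0 : 'I_p,
    [set s (initial i) | i in 'I_p & P i == P i0]%SET ==
    [set s' (initial i) | i in 'I_p & P i == P i0]%SET].

Definition x_wedge : ext p S T :=
  \sum_(s in transversal (equivalence_partition same_blocks [set: 'S_p.+1]%SET)
                         [set: 'S_p.+1]%SET)
    (-1) ^+ s *: wedge (shifted s) (Q (s ord_max)).

End Elements.
End Koszul.

Definition monomial (X : choiceType) (p : nat) : choiceType :=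
  {A : {cmonom X} | mdeg A == p}.

Definition lists (X : choiceType) (p : nat) (A : {cmonom X})
    (P : {ffun 'I_p -> X}) : Prop :=
  forall x : X, #|[pred i | P i == x]| = A x.

(* Main.v *)
Require Import Defs.
From HB Require Import structures.
From mathcomp Require Import all_boot all_order all_fingroup all_algebra.
From mathcomp Require Import finmap boolp classical_sets reals.
From mathcomp Require Import freeg mpoly ring lra interval_inference.
Set Implicit Arguments.
Unset Strict Implicit.
Unset Printing Implicit Defensive.
Import Order.TTheory GRing.Theory Num.Theory.
Local Open Scope classical_set_scope.
Local Open Scope ring_scope.

(* With one block [x_i] of [n] variables for each of the [p] slots, an element
   of V_S^p (x) V_T is a vector [F] of [p + 1] Laurent polynomials, one for each
   point of [T], and it is killed by all the [delta_i] iff [F] is in the kernel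
   of the matrix [x_i ^ Q_j], with [p] rows.  This kernel has rank one and
   contains the vector [d] of the signed maximal minors, and x_{P_1, ..., P_p}
   is [d] multiplied by the monomial of the [P_i].  So it has to be shown that
   [F = c d] for a Laurent polynomial [c] with support in X^p.

   As polynomial rings are gcd domains, [F = c g] and [d = h g].  In the block
   [i], let [A] and [B] be the supports of [h] and of the [g_j]; then
   [A + B] lies in [T], since the Newton polytope of a product is the sum of the
   Newton polytopes.  Each substitution [x_i := x_l] kills [d], so it kills [h]
   or all the [g_j], and vanishing at [a] generic points forces more than [a]
   coefficients.  This gives #A + #B >= p + 2 = #T + 1; if #A > 1, then [A] and
   [B] are arithmetic progressions with the same difference, so that [T] is
   contained in a line.  Hence [h] is a monomial.  That the support of [c] is in
   X^p follows from Newton polytopes again, as Delta' is convex.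

   For the exterior power, alternation embeds it into the tensor power, where
   [x_A] becomes the sum of the [x_P] for the distinct permutations [P] of a
   list of [A]. *)

(** * Gauss's lemma and greatest common divisors of polynomials *)

(** Here [e] is a gcd of [f] and [g]. That [c] and [h] are coprime is expressed by Euclid's lemma:
    [h] divides [x] as soon as it divides [c * x]. *)
Definition gcd_domain (R : idomainType) : Prop :=
  forall f g : R, g != 0 -> exists e c h : R,
    [/\ f = e * c, g = e * h &
        forall x y, c * x = h * y -> exists z, x = h * z].

Section Gauss.
Variable R : idomainType.
Implicit Types (a b d s y z : R) (f g q : {poly R}).

(** Content one, expressed by divisibility of all multiples [y *: f] instead of a content
    function. *)
Definition primitive f : Prop :=
  forall s y g, s *: g = y *: f -> exists z, y = s * z.

Lemma primitive_neq0 f : primitive f -> f != 0.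
Proof.
move=> fP; apply/eqP => f0; have [|z /eqP] := fP 0 1 0.
  by rewrite f0 !scaler0.
by rewrite mul0r oner_eq0.
Qed.

Lemma primitive_const_dvd f s g : primitive f -> f = s *: g -> exists z, 1 = s * z.
Proof. by move=> fP fE; apply: (fP s 1 g); rewrite scale1r. Qed.

Hypothesis gcdR : gcd_domain R.

(** The content of [p * 'X + c] is the gcd of [c] and the content of [p]. *)
Lemma primitive_part f : f != 0 ->
  exists d f', [/\ d != 0, f = d *: f' & primitive f'].
Proof.
have prim1 : primitive 1.
  move=> s y g /(congr1 (fun p : {poly R} => p`_0)).
  by rewrite !coefZ coefC mulr1 => <-; exists g`_0.
elim/poly_ind: f => [|p c IH]; first by rewrite eqxx.
have [->|p0] := eqVneq p 0.
  rewrite mul0r add0r polyC_eq0 => c0; exists c, 1; split=> //.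
  by rewrite -mul_polyC mulr1.
move=> _; have [d [p' [d0 pE p'P]]] := IH p0.
have [e [c' [h [cE dE co]]]] := gcdR c d0.
have [e0 h0] : e != 0 /\ h != 0 by apply/andP; rewrite -negb_or -mulf_eq0 -dE.
exists e, (h *: p' * 'X + c'%:P); split=> //.
  by rewrite pE cE dE scalerDr -!mul_polyC !polyCM !mulrA.
move=> s y g sg; have [s0|s0] := eqVneq s 0.
  exists 0; rewrite mulr0; apply/eqP; move/eqP: sg.
  rewrite s0 scale0r eq_sym -mul_polyC mulf_eq0 polyC_eq0 => /orP[//|].
  rewrite -size_poly_eq0 size_MXaddC -mul_polyC mulf_eq0 polyC_eq0.
  by rewrite (negPf h0) (negPf (primitive_neq0 p'P)).
(* The coefficients of positive degree show that [s] divides [y * h], the constant one that it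
   divides [y * c']. As [c'] and [h] are coprime, [s] divides [y]. *)
have [|z yh] := p'P s (y * h) (\poly_(i < size g) g`_i.+1).
  apply/polyP => i; rewrite !coefZ coef_poly.
  have := congr1 (fun p : {poly R} => p`_i.+1) sg.
  rewrite /= !coefZ coefD coefMX coefC /= addr0 coefZ mulrA => <-.
  case: ltnP => // /leqW sz; rewrite nth_default //.
have := congr1 (fun p : {poly R} => p`_0) sg.
rewrite /= !coefZ coefD coefMX coefC /= add0r => sg0.
have [|z' zE] := co z (g`_0).
  apply: (mulfI s0); rewrite mulrCA -yh [RHS]mulrCA sg0.
  by rewrite mulrCA [RHS]mulrCA [c' * h]mulrC.
by exists z'; apply: (mulIf h0); rewrite yh zE [h * _]mulrC mulrA.
Qed.

(* The step of the induction for Gauss's lemma: if a constant divides [f * q]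
   and the leading coefficient of [f], remove the leading term of [f]. *)
Lemma lead_dvd_primitive f q s g :
  (forall f', (size f' < size f)%N -> primitive f' -> primitive (f' * q)) ->
  primitive f -> s *: g = f * q -> (exists t, lead_coef f = s * t) ->
  exists z, 1 = s * z.
Proof.
move=> IH fP sg [t ft]; have f0 := primitive_neq0 fP.
set n := (size f).-1; set f1 := f - lead_coef f *: 'X^n.
have fE : f = f1 + lead_coef f *: 'X^n by rewrite /f1 subrK.
have [f1z|f1n] := eqVneq f1 0.
  by apply: (primitive_const_dvd fP (g := t *: 'X^n)); rewrite scalerA -ft {1}fE f1z add0r.
have [d [f' [d0 f1E f'P]]] := primitive_part f1n.
have sz1 : (size f' < size f)%N.
  have -> : size f' = size f1 by rewrite f1E size_scale.
  have szf : (0 < size f)%N by rewrite size_poly_gt0.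
  rewrite -[X in (_ < X)%N](prednK szf) ltnS; apply/leq_sizeP => j.
  rewrite leq_eqVlt /f1 coefB coefZ coefXn => /orP[/eqP <-|jn].
    by rewrite eqxx mulr1 subrr.
  rewrite gtn_eqF // mulr0 subr0 nth_default //.
  by move: jn; rewrite /n; case: (size f) szf.
have [|z dE] := IH _ sz1 f'P s d (g - t *: 'X^n * q).
  by rewrite scalerBr sg [d *: _]scalerAl -f1E /f1 mulrBl ft -!scalerAl scalerA.
apply: (primitive_const_dvd fP (g := z *: f' + t *: 'X^n)).
by rewrite scalerDr !scalerA -ft -dE -f1E -fE.
Qed.

(** Induction on the total size. A constant [s] dividing [f * q] divides the product of the leading
    coefficients. Its gcd [e] with that of [f] is a unit by [lead_dvd_primitive], so [s] divides
    that of [q], and the same lemma applies with [f] and [q] exchanged. *)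
Lemma primitiveM f q : primitive f -> primitive q -> primitive (f * q).
Proof.
have [N] := ubnP (size f + size q); elim: N f q => // N IH f q.
rewrite ltnS => szN fP qP.
suff dvd1 s g : s *: g = f * q -> exists z, 1 = s * z.
  have fq0 : f * q != 0 by rewrite mulf_neq0 ?primitive_neq0.
  have [d [r [d0 fqE rP]]] := primitive_part fq0.
  have [u dE] := dvd1 d r (esym fqE).
  move=> s y g sg; rewrite fqE scalerA in sg.
  have [z ydE] := rP _ _ _ sg.
  by exists (z * u); rewrite mulrA -ydE -mulrA -dE mulr1.
move=> sg; have a0 : lead_coef f != 0 by rewrite lead_coef_eq0 primitive_neq0.
have [e [s' [a' [sE aE co]]]] := gcdR s a0.
have [e0 a'0] : e != 0 /\ a' != 0 by apply/andP; rewrite -negb_or -mulf_eq0 -aE.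
have [|||u eE] := @lead_dvd_primitive f q e (s' *: g) _ fP.
- move=> f' szf' f'P; apply: IH => //; apply: leq_trans szN.
  by rewrite ltn_add2r.
- by rewrite scalerA -sE.
- by exists a'.
have [t tE] : exists t, lead_coef f * lead_coef q = s * t.
  by exists g`_(size (s *: g)).-1; rewrite -lead_coefM lead_coefE -sg coefZ.
have [z a'z] : exists z, lead_coef q = s' * z.
  have := tE; rewrite aE sE -!mulrA => /(mulfI e0) abE.
  have [z tz] := co t (lead_coef q) (esym abE).
  by exists z; apply: (mulfI a'0); rewrite abE tz mulrCA.
apply: (@lead_dvd_primitive q f s g _ qP).
- move=> q' szq' q'P; rewrite mulrC; apply: IH => //; apply: leq_trans szN.
  by rewrite ltn_add2l.
- by rewrite mulrC.
by exists (u * z); rewrite a'z sE mulrACA -eE mul1r.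
Qed.

Lemma Gauss_const_dvd f q s g :
  primitive f -> s *: g = q * f -> exists q', q = s *: q'.
Proof.
move=> fP sg; have [->|q0] := eqVneq q 0; first by exists 0; rewrite scaler0.
have [d [q' [d0 qE q'P]]] := primitive_part q0.
have [|z dE] := primitiveM q'P fP (s := s) (y := d) (g := g).
  by rewrite sg {1}qE scalerAl.
by exists (z *: q'); rewrite scalerA -dE.
Qed.

Lemma primitive_factor f q : primitive (q * f) -> primitive q.
Proof.
move=> qfP s y g sg; apply: (qfP s y (g * f)).
by rewrite scalerAl sg scalerAl.
Qed.

Import Pdiv.CommonIdomain.

(** The relation [%|] only makes some nonzero constant multiple [s *: q] a multiple of [f]; by
    Gauss's lemma [s] can be cancelled from the cofactor. *)
Lemma primitive_dvdp f q : primitive f -> (f %| q)%R -> exists q', q = q' * f.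
Proof.
move=> fP /Pdiv.WeakIdomain.dvdpP[[s g] /= s0 sq].
have [g' gE] := Gauss_const_dvd fP sq.
exists g'; apply: (@mulfI _ s%:P); rewrite ?polyC_eq0 // !mul_polyC.
by rewrite sq gE -scalerAl.
Qed.

(** The gcd is the gcd [e] of the contents times the primitive part [H] of [gcdp] of the primitive
    parts. *)
Lemma gcd_domain_poly : gcd_domain {poly R}.
Proof.
move=> f g g0; have [->|f0] := eqVneq f 0.
  exists g, 0, 1; split; rewrite ?mulr0 ?mulr1 // => x y.
  by exists x; rewrite mul1r.
have [a [f1 [a0 fE f1P]]] := primitive_part f0.
have [b [g1 [b0 gE g1P]]] := primitive_part g0.
have f1n := primitive_neq0 f1P; have g1n := primitive_neq0 g1P.
have dn0 : gcdp f1 g1 != 0 by rewrite gcdp_eq0 negb_and f1n.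
have [d [H [d0 HE HP]]] := primitive_part dn0.
have [f2 f1E] : exists f2, f1 = f2 * H.
  by apply: primitive_dvdp => //; rewrite -(dvdpZl _ _ d0) -HE dvdp_gcdl.
have [g2 g1E] : exists g2, g1 = g2 * H.
  by apply: primitive_dvdp => //; rewrite -(dvdpZl _ _ d0) -HE dvdp_gcdr.
have f2P : primitive f2 by apply: (@primitive_factor H); rewrite -f1E.
have g2P : primitive g2 by apply: (@primitive_factor H); rewrite -g1E.
have Hn0 := primitive_neq0 HP.
have co2 : coprimep g2 f2.
  rewrite -gcdp_eqp1 -(eqp_mul2r _ _ Hn0) mul1r (eqp_ltrans (mulp_gcdl _ _ _)).
  rewrite -f1E -g1E (eqp_ltrans (gcdpC _ _)) HE; exact: eqp_scale.
have [e [a' [b' [aE bE co]]]] := gcdR a b0.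
exists (e *: H), (a' *: f2), (b' *: g2); split.
- by rewrite fE f1E aE -scalerAl -scalerAr scalerA [H * _]mulrC.
- by rewrite gE g1E bE -scalerAl -scalerAr scalerA [H * _]mulrC.
move=> x y xy; have a'0 : a' != 0 by apply: contraNneq a0; rewrite aE => ->; rewrite mulr0.
(* Being coprime to [f2], [g2] divides [x] up to constants, and being primitive it divides [x]
   itself. The constant [b'] then divides the cofactor [u] coefficient by coefficient. *)
have [|u xE] := @primitive_dvdp g2 x g2P.
  rewrite -(Gauss_dvdpr _ co2) -(dvdpZr _ _ a'0) scalerAl xy -scalerAl scalerAr.
  exact: dvdp_mulr.
have [|w wE] := @Gauss_const_dvd f2 (a' *: u) b' y f2P.
  apply: (mulfI (primitive_neq0 g2P)).
  by rewrite -scalerAr scalerAl -xy xE -!scalerAl -scalerAr mulrCA [f2 * _]mulrC [in RHS]mulrCA.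
have /choice[z zE] i : exists z, u`_i = b' * z.
  by apply: (co _ w`_i); rewrite -!coefZ wE.
exists (\poly_(i < size u) z i); rewrite xE -scalerAl scalerAr mulrC; congr (_ * _).
apply/polyP => i; rewrite coefZ coef_poly; case: ltnP => [|sz]; first by rewrite -zE.
by rewrite mulr0 nth_default.
Qed.

End Gauss.

Lemma gcd_domain_field (k : fieldType) : gcd_domain k.
Proof.
move=> f g g0; exists g, (f / g), 1; rewrite mulr1; split=> [|//|x y _].
  by rewrite mulrCA divff ?mulr1.
by exists x; rewrite mul1r.
Qed.

Lemma gcd_domain_iso (A B : idomainType) (phi : {rmorphism A -> B}) :
  bijective phi -> gcd_domain B -> gcd_domain A.
Proof.
case=> psi phiK psiK gcdB f g g0; have phiI := can_inj phiK.
have [|e [c [h [fE gE co]]]] := gcdB (phi f) (phi g).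
  by rewrite -(rmorph0 phi) (inj_eq phiI).
exists (psi e), (psi c), (psi h); split; first 2 last.
- move=> x y /(congr1 phi); rewrite !rmorphM /= !psiK => /co[z xz].
  by exists (psi z); apply: phiI; rewrite rmorphM /= !psiK.
- by apply: phiI; rewrite rmorphM /= !psiK.
- by apply: phiI; rewrite rmorphM /= !psiK.
Qed.

(** * Polynomials in several variables, one variable at a time *)

Section Muni.
Variables (R : idomainType) (n : nat).

Local Notation restr m := [multinom m (widen_ord (leqnSn n) i) | i < n].

Lemma muniX (m : 'X_{1..n.+1}) :
  muni 'X_[R, m] = 'X_[R, restr m] *: 'X^(m ord_max).
Proof. by rewrite muniE msuppX big_seq1 mcoeffX eqxx scale1r. Qed.

Lemma muni_inj : injective (@muni n R).
Proof.
apply: raddf_inj => p /= p0; apply/mpolyP => m; rewrite mcoeff0.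
have := congr1 (fun q : {poly {mpoly R[n]}} => q`_(m ord_max)@_(restr m)) p0.
rewrite /= muniE coef0 mcoeff0 => <-.
rewrite coef_sum raddf_sum /= {1}(mpolyE p) raddf_sum /=; apply: eq_bigr => m' _.
rewrite coefZ coefXn -scalerAl !mcoeffZ mcoeffX; congr (_ * _).
have [->|mm'] := eqVneq m' m; first by rewrite eqxx mulr1 mcoeffX eqxx.
have [e1|//] := eqVneq (m ord_max) (m' ord_max); last by rewrite mulr0 mcoeff0.
rewrite mulr1 mcoeffX; case: eqP => // /mnmP e2; case/eqP: mm'.
apply/mnmP => i; case: (unliftP ord_max i) => [j ->|-> //].
have := e2 j; rewrite !mnmE.
have -> : widen_ord (leqnSn n) j = fintype.lift ord_max j.
  by apply: val_inj; rewrite /= /bump leqNgt ltn_ord.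
by [].
Qed.

Lemma muni_bij : bijective (@muni n R).
Proof.
have muni_widen (q : {mpoly R[n]}) : muni (mwiden q) = q%:P.
  rewrite {1}(mpolyE q) [mwiden _]raddf_sum /= [muni _]raddf_sum /=.
  rewrite [in RHS](mpolyE q) raddf_sum /=.
  apply: eq_bigr => m _; rewrite mwidenZ mwidenX muniZ muniX mnmwiden_ordmax.
  rewrite expr0 scalerA alg_polyC mul_mpolyC; congr (_ *: 'X_[_])%:P.
  by apply/mnmP => i; rewrite mnmE mnmwiden_widen.
have muniM_max : muni ('X_ord_max : {mpoly R[n.+1]}) = 'X.
  rewrite muniX mnmE eqxx expr1.
  have -> : restr U_(ord_max : 'I_n.+1)%MM = 0%MM.
    apply/mnmP => i; rewrite !mnmE /=; apply/eqP; rewrite eqb0.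
    by rewrite -val_eqE /= eq_sym neq_ltn ltn_ord.
  by rewrite mpolyX0 scale1r.
exists (@mmulti n R) => p; last first.
  rewrite /mmulti raddf_sum /= -[RHS]coefK poly_def; apply: eq_bigr => i _.
  by rewrite rmorphM rmorphXn /= muni_widen muniM_max mul_polyC.
apply: muni_inj; rewrite /mmulti raddf_sum /= -[RHS]coefK poly_def.
apply: eq_bigr => i _.
by rewrite rmorphM rmorphXn /= muni_widen muniM_max mul_polyC.
Qed.

End Muni.

Lemma gcd_domain_mpoly (R : idomainType) n :
  gcd_domain R -> gcd_domain {mpoly R[n]}.
Proof.
move=> gcdR; elim: n => [|n IH].
  apply: (@gcd_domain_iso {mpoly R[0]} R (mcoeff 0%MM)) => //.
  by exists (@mpolyC 0 R); [exact: mpolyKC | exact: mpolyCK].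
by apply: gcd_domain_iso (muni_bij R n) _; apply: gcd_domain_poly.
Qed.

(** In lowest terms [f i0 / g i0] is [c / h]. Proportionality gives [c * g i = h * f i], so [h]
    divides every [g i], and the quotients serve for [f] too. *)
Lemma proportional_common_factor (R : idomainType) (I : Type)
    (f g : I -> R) (i0 : I) : gcd_domain R -> g i0 != 0 ->
  (forall i j, f i * g j = f j * g i) ->
  exists (c h : R) (q : I -> R), forall i, f i = c * q i /\ g i = h * q i.
Proof.
move=> gcdR gi0 prop; have [e [c [h [fE gE co]]]] := gcdR (f i0) (g i0) gi0.
have [e0 h0] : e != 0 /\ h != 0 by apply/andP; rewrite -negb_or -mulf_eq0 -gE.
have cgE i : c * g i = h * f i.
  by apply: (mulfI e0); rewrite !mulrA -fE -gE prop mulrC.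
have /choice[q qE] i := co (g i) (f i) (cgE i).
exists c, h, q => i; split=> //; apply: (mulfI h0).
by rewrite -cgE qE mulrCA.
Qed.

(** * Newton polytopes and sumsets of lattice points *)

Section Convexity.
Variables (K : realType) (n : nat).
Implicit Types (x y v w : 'rV[K]_n) (C : set 'rV[K]_n).

Lemma convexP C : convex C <->
  (forall x y (t : K), 0 <= t -> t <= 1 -> C x -> C y ->
    C (t *: x + (1 - t) *: y)).
Proof.
split=> [cC x y t t0 t1 Cx Cy|cC x y t Cx Cy].
  by have /set_mem := cC x y (Itv01 t0 t1) (mem_set Cx) (mem_set Cy).
apply/mem_set; apply: cC; [exact: ge0 | exact: le1 | exact: set_mem | exact: set_mem].
Qed.

(** This set is the convex hull of [v] and [C]; it serves to drop [v] from a generating set in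
    [convex_midpoints]. *)
Lemma convex_cone C v : convex C -> C !=set0 -> 
  convex [set x | exists t y, [/\ 0 <= t, t <= 1, C y & x = t *: v + (1 - t) *: y]].
Proof.
move=> /convexP cC [y0 Cy0]; apply/convexP => ? ? s s0 s1.
move=> [t [y [t0 t1 Cy ->]]] [u [z [u0 u1 Cz ->]]].
pose g := s * t + (1 - s) * u.
have g0 : 0 <= g by rewrite /g; nra.
have g1 : g <= 1 by rewrite /g; nra.
have st : 0 <= s * (1 - t) by rewrite mulr_ge0 ?subr_ge0.
have su : 0 <= (1 - s) * (1 - u) by rewrite mulr_ge0 ?subr_ge0.
have gE : 1 - g = s * (1 - t) + (1 - s) * (1 - u) by rewrite /g; ring.
(* If [g = 1], all the weight is on [v] and the quotient [r] below makes no sense; any point of [C]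
   will do. *)
have [g1e|gn1] := eqVneq g 1.
  exists g, y0; split=> //; apply/rowP => i; rewrite !mxE.
  have e1 : s * (1 - t) = 0 by lra.
  have e2 : (1 - s) * (1 - u) = 0 by lra.
  have -> : s * (t * v 0 i + (1 - t) * y 0 i) +
      (1 - s) * (u * v 0 i + (1 - u) * z 0 i) =
      g * v 0 i + (s * (1 - t)) * y 0 i + ((1 - s) * (1 - u)) * z 0 i.
    by rewrite /g; ring.
  by rewrite e1 e2 g1e subrr; ring.
have gp : 0 < 1 - g by rewrite subr_gt0 lt_neqAle gn1.
pose r := s * (1 - t) / (1 - g).
have r0 : 0 <= r by rewrite divr_ge0 // ltW.
have r1 : r <= 1 by rewrite ler_pdivrMr // mul1r gE lerDl.
exists g, (r *: y + (1 - r) *: z); split=> //; first exact: cC.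
have rE : r * (1 - g) = s * (1 - t) by rewrite /r divfK // gt_eqF.
have r'E : (1 - r) * (1 - g) = (1 - s) * (1 - u).
  by rewrite mulrBl rE gE mul1r; ring.
apply/rowP => i; rewrite !mxE.
have -> : g * v 0 i + (1 - g) * (r * y 0 i + (1 - r) * z 0 i) =
  g * v 0 i + (r * (1 - g)) * y 0 i + ((1 - r) * (1 - g)) * z 0 i by ring.
by rewrite rE r'E /g; ring.
Qed.

Lemma convex1 v : convex [set v].
Proof.
by apply/convexP => ? ? t _ _ -> ->; rewrite -scalerDl addrC subrK scale1r.
Qed.

(* Take a minimal part of [W] generating the convex hull of [W]: none of its
   points is the midpoint of two other points of [W]. *)
Lemma convex_midpoints C (U : set 'rV[K]_n) (W : seq 'rV[K]_n) : convex C ->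
  (forall w, w \in W -> U w \/ exists w1 w2,
     [/\ w1 \in W, w2 \in W, w1 != w, w2 != w & w + w = w1 + w2]) ->
  (forall w, w \in W -> U w -> C w) -> forall w, w \in W -> C w.
Proof.
move=> cC WU UC.
(* [gen V] says that the convex hull of [V] contains [W]. *)
pose gen (V : seq 'rV[K]_n) := forall D, convex D -> (forall v, v \in V -> D v) ->
  forall w, w \in W -> D w.
suff main N V : (size V < N)%N -> {subset V <= W} -> gen V ->
    forall w, w \in W -> C w by apply: (main _ W (ltnSn _)) => // D _.
elim: N V => // N IH V; rewrite ltnS => szV VW genV.
have [VU|nVU] := pselect (forall v, v \in V -> U v).
  by apply: genV => // v vV; apply: UC; [exact: VW | exact: VU].
have [v [vV nUv]] : exists v, v \in V /\ ~ U v.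
  apply: contrapT => nex; apply: nVU => v vV; apply: contrapT => nUv.
  by apply: nex; exists v.
have [//|[w1 [w2 [w1W w2W w1v w2v vE]]]] := WU _ (VW _ vV).
apply: (IH (filter (predC1 v) V)).
- apply: leq_trans szV; rewrite size_filter -(count_predC (predC1 v) V).
  rewrite -[X in (X < _)%N]addn0 ltn_add2l -has_count; apply/hasP; exists v => //=.
  by rewrite eqxx.
- by move=> x; rewrite mem_filter => /andP[_]; exact: VW.
move=> D cD DV; suff Dv : D v.
  apply: genV => // x xV; have [->//|xv] := eqVneq x v.
  by apply: DV; rewrite mem_filter /= xv.
have [|D0] := pselect (D !=set0); last first.
  have := genV [set v] (@convex1 _) => /(_ _ _ w1W) ev; case/eqP: w1v.
  apply: ev => x xV; have [->//|xv] := eqVneq x v.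
  by case: D0; exists x; apply: DV; rewrite mem_filter /= xv.
move=> Dn0; have := genV _ (@convex_cone D v cD Dn0).
have [y0 Dy0] := Dn0 => H.
have {}H w : w \in W -> exists t y, [/\ 0 <= t, t <= 1, D y & w = t *: v + (1 - t) *: y].
  apply: H => x xV; have [->|xv] := eqVneq x v.
    by exists 1, y0; split=> //; rewrite scale1r subrr scale0r addr0.
  exists 0, x; split=> //; last by rewrite scale0r add0r subr0 scale1r.
  by apply: DV; rewrite mem_filter /= xv.
have lt1 w t y : w != v -> t <= 1 -> w = t *: v + (1 - t) *: y -> t < 1.
  move=> wv t1 wE; rewrite lt_neqAle t1 andbT; apply: contra wv => /eqP te.
  by rewrite wE te scale1r subrr scale0r addr0.
have [t [y [t0 t1 Dy yE]]] := H _ w1W; have [u [z [u0 u1 Dz zE]]] := H _ w2W.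
have {}t1 := lt1 _ _ _ w1v t1 yE; have {}u1 := lt1 _ _ _ w2v u1 zE.
(* Inserting both expressions in [v + v = w1 + w2] and solving for [v] gives a convex combination of
   [y] and [z] with weights proportional to [1 - t] and [1 - u], which are positive since [w1] and
   [w2] differ from [v]. *)
pose s := (1 - t) + (1 - u); have s0 : 0 < s by rewrite /s; lra.
have -> : v = ((1 - t) / s) *: y + (1 - (1 - t) / s) *: z.
  apply/rowP => i; have := congr1 (fun x : 'rV[K]_n => x 0 i) vE.
  rewrite yE zE !mxE => vi.
  have e : s * v 0 i = (1 - t) * y 0 i + (1 - u) * z 0 i by rewrite /s; lra.
  have rs : s * ((1 - t) / s) = 1 - t by rewrite mulrC divfK // lt0r_neq0.
  apply: (mulfI (lt0r_neq0 s0)); rewrite e; move: ((1 - t) / s) rs => r rs.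
  have -> : s * (r * y 0 i + (1 - r) * z 0 i) =
    (s * r) * y 0 i + (s - s * r) * z 0 i by ring.
  by rewrite rs /s; ring.
move/convexP: cD; apply=> //; first by rewrite divr_ge0 ?subr_ge0 ?ltW.
by rewrite ler_pdivrMr // mul1r /s; lra.
Qed.

End Convexity.

Section Newton.
Variables (K : realType) (n : nat).

Definition mvec (m : 'X_{1..n}) : 'rV[K]_n := \row_i (m i)%:R.

Lemma mvecD (a b : 'X_{1..n}) : mvec (a + b)%MM = mvec a + mvec b.
Proof. by apply/rowP => i; rewrite !mxE mnmDE natrD. Qed.

Lemma mvec_inj : injective mvec.
Proof.
move=> a b /rowP ab; apply/mnmP => i; apply/eqP; rewrite -(eqr_nat K).
by have := ab i; rewrite !mxE => ->.
Qed.

(** Nothing cancels at an exponent that is a sum in one way only, such as a vertex of the sum of the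
    Newton polytopes. *)
Lemma mcoeffM_unique (R : idomainType) (f g : {mpoly R[n]}) (a b : 'X_{1..n}) :
  a \in msupp f -> b \in msupp g ->
  (forall a' b', a' \in msupp f -> b' \in msupp g ->
     (a' + b')%MM = (a + b)%MM -> a' = a /\ b' = b) ->
  (f * g)@_(a + b) = f@_a * g@_b.
Proof.
move=> fa gb uniq_ab; rewrite mpolyME raddf_sum /=.
rewrite (bigD1_seq (a, b)) ?allpairs_uniq ?msupp_uniq //=; last 2 first.
- by apply/allpairsP; exists (a, b).
- by case=> ? ? [].
rewrite mcoeffZ mcoeffX eqxx mulr1 big_seq_cond big1 ?addr0 // => -[a' b'].
case/andP=> /allpairsP[[x y] /= [xf yg [-> ->]]] ne.
rewrite mcoeffZ mcoeffX; case: eqP => [e|_]; last by rewrite mulr0.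
by have [xa yb] := uniq_ab _ _ xf yg e; rewrite xa yb eqxx in ne.
Qed.

(* The Newton polytope of a product is the Minkowski sum of the Newton
   polytopes of the factors. *)
Lemma msuppM_convex (R : idomainType) (f g : {mpoly R[n]}) (C : set 'rV[K]_n) :
  convex C -> (forall m, m \in msupp (f * g) -> C (mvec m)) ->
  forall a b, a \in msupp f -> b \in msupp g -> C (mvec (a + b)%MM).
Proof.
move=> cC fgC a b fa gb.
pose W := [seq mvec (x + y)%MM | x <- msupp f, y <- msupp g].
(* [U] holds the sums with a unique decomposition, which survive in the product. Any other sum
   [x + y = x' + y'] is the midpoint of [x + y'] and [x' + y], so [convex_midpoints] applies. *)
pose U := [set w | exists x y, [/\ x \in msupp f, y \in msupp g, w = mvec (x + y)%MM &
  forall x' y', x' \in msupp f -> y' \in msupp g ->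
     (x' + y')%MM = (x + y)%MM -> x' = x /\ y' = y]].
apply: (@convex_midpoints K n C U W) => //; first last.
- by apply/allpairsP; exists (a, b).
- move=> w _ [x [y [xf yg -> xy]]]; apply: fgC.
  by rewrite mcoeff_msupp mcoeffM_unique // mulf_neq0 -?mcoeff_msupp.
move=> _ /allpairsP[[x y] /= [xf yg ->]].
have [Uxy|nU] := pselect (U (mvec (x + y)%MM)); [by left | right].
have [x' [y' [xf' yg' e ne]]] : exists x' y', [/\ x' \in msupp f, y' \in msupp g,
    (x' + y')%MM = (x + y)%MM & x' != x].
  apply: contrapT => nex; apply: nU; exists x, y; split=> // x' y' xf' yg' e.
  have [xx|ne] := eqVneq x' x; last by case: nex; exists x', y'.
  by split=> //; move: e; rewrite xx => /addmI.
exists (mvec (x + y')%MM), (mvec (x' + y)%MM); split.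
- by apply/allpairsP; exists (x, y').
- by apply/allpairsP; exists (x', y).
- rewrite (inj_eq mvec_inj); apply: contra ne => /eqP/addmI yy.
  by move/eqP: e; rewrite yy eqm_add2r.
- by rewrite (inj_eq mvec_inj) eqm_add2r.
by rewrite -mvecD -{1}e -mvecD; congr mvec; apply/mnmP => i; rewrite !mnmDE; ring.
Qed.

End Newton.

Lemma seq_max (d : Order.disp_t) (T : orderType d) (s : seq T) : s != [::] ->
  exists2 t, t \in s & forall x, x \in s -> (x <= t)%O.
Proof.
elim: s => // x s IH _; have [->|s0] := eqVneq s [::].
  by exists x => [|y]; rewrite inE // => /eqP ->.
have [t ts tmax] := IH s0; exists (Order.max x t) => [|y].
  by rewrite maxEle; case: ifP; rewrite inE ?eqxx ?ts ?orbT.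
by rewrite inE le_max => /predU1P[->|/tmax ->]; rewrite ?lexx ?orbT.
Qed.

(** * Small sumsets, counted with the monomial order *)

Section Sumsets.
Variable n : nat.
Implicit Types (a b : 'X_{1..n}) (A B : seq 'X_{1..n}).

Definition sums A B := undup [seq (a + b)%MM | a <- A, b <- B].

Lemma sumsP A B m :
  reflect (exists a b, [/\ a \in A, b \in B & m = (a + b)%MM]) (m \in sums A B).
Proof.
rewrite mem_undup; apply: (iffP allpairsP) => [[[a b] []]|[a [b []]]].
  by exists a, b.
by exists (a, b).
Qed.

(** The sum of [a] and the largest element of [B] exceeds every element of [sums A B]. *)
Lemma size_sums_rcons A B a : B != [::] -> all (fun x => x < a)%O A ->
  (size (sums A B) < size (sums (rcons A a) B))%N.
Proof.
move=> /seq_max[b bB bmax] /allP ltA.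
have : uniq (rcons (sums A B) (a + b)%MM).
  rewrite rcons_uniq undup_uniq andbT; apply/sumsP => -[x [y [xA yB e]]].
  have : ((x + y)%MM < (a + b)%MM)%O by apply: ltmc_le_add; [exact: ltA | exact: bmax].
  by rewrite -e ltxx.
move/uniq_leq_size => /(_ (sums (rcons A a) B)); rewrite size_rcons; apply.
move=> m; rewrite mem_rcons inE => /orP[/eqP ->|/sumsP[x [y [xA yB ->]]]].
  by apply/sumsP; exists a, b; rewrite mem_rcons mem_head.
by apply/sumsP; exists x, y; rewrite mem_rcons inE xA orbT.
Qed.

Lemma size_sums_sorted A1 A2 B : B != [::] -> sorted <%O (A1 ++ A2) ->
  (size (sums A1 B) + size A2 <= size (sums (A1 ++ A2) B))%N.
Proof.
move=> B0; elim/last_ind: A2 => [|A2 a IH]; first by rewrite cats0 addn0.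
rewrite -rcons_cat => srt; rewrite size_rcons addnS.
have srt' : sorted <%O (A1 ++ A2) by move: srt; rewrite -cats1 => /cat_sorted2[].
apply: leq_ltn_trans (IH srt') _; apply: size_sums_rcons => //.
by move: srt; rewrite (sorted_pairwise lt_trans) pairwise_rcons => /andP[].
Qed.

Lemma sums_perm A A' B : A =i A' -> sums A B =i sums A' B.
Proof.
by move=> AA m; apply/sumsP/sumsP => -[a [b [aA bB ->]]]; exists a, b;
  rewrite ?AA // -AA.
Qed.

Lemma size_sums_perm A A' B : A =i A' -> size (sums A B) = size (sums A' B).
Proof.
by move=> AA; apply/perm_size/uniq_perm; rewrite ?undup_uniq //; exact: sums_perm.
Qed.

Lemma sumsC A B : sums A B =i sums B A.
Proof.
by move=> m; apply/sumsP/sumsP => -[a [b [aA bB ->]]]; exists b, a; rewrite addmC.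
Qed.

Lemma size_sumsC A B : size (sums A B) = size (sums B A).
Proof. by apply/perm_size/uniq_perm; rewrite ?undup_uniq //; exact: sumsC. Qed.

Definition zvec (m : 'X_{1..n}) : 'rV[int]_n := \row_i (m i)%:Z.

Lemma zvecD a b : zvec (a + b)%MM = zvec a + zvec b.
Proof. by apply/rowP => i; rewrite !mxE mnmDE PoszD. Qed.

(** With [t] the largest element of [B], the translate [a1 + B] and the larger sum [a2 + t] leave no
    room for another sum. So [b + (a2 - a1)] lies in [B] again for every [b] in [B] other than [t],
    and repeating this step leads up to [t]. *)
Lemma size_sums_pair (a1 a2 : 'X_{1..n}) B : (a1 < a2)%O -> uniq B ->
  (size (sums [:: a1; a2] B) <= (size B).+1)%N ->
  exists t, forall b, b \in B ->
    exists m : nat, zvec b = zvec t - (zvec a2 - zvec a1) *+ m.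
Proof.
move=> a12 uB; have [->|B0 szB] := eqVneq B [::]; first by exists 0%MM.
have [t tB tmax] := seq_max B0.
have step b : b \in B -> b != t -> exists2 b', b' \in B & (b + a2 = b' + a1)%MM.
  move=> bB bt; apply/exists2P; apply: contrapT => nex.
  suff : (size (rcons (rcons [seq (x + a1)%MM | x <- B] (t + a2)%MM) (b + a2)%MM) <=
      size (sums [:: a1; a2] B))%N.
    rewrite !size_rcons size_map => /leq_trans/(_ szB).
    by rewrite ltnn.
  apply: uniq_leq_size.
    rewrite !rcons_uniq map_inj_uniq ?uB ?andbT; last exact: addIm.
    apply/andP; split.
      rewrite mem_rcons inE eqm_add2r negb_or bt /=.
      by apply/mapP => -[b' b'B e]; apply: nex; exists b'.
    apply/mapP => -[b' b'B e].
    have : ((a1 + b')%MM < (a2 + t)%MM)%O by apply: ltmc_le_add => //; exact: tmax.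
    by rewrite addmC -e addmC ltxx.
  move=> m; rewrite !(mem_rcons, inE) => /or3P[/eqP->|/eqP->|/mapP[x xB ->]].
  - by apply/sumsP; exists a2, b; rewrite !inE eqxx orbT addmC.
  - by apply/sumsP; exists a2, t; rewrite !inE eqxx orbT addmC.
  - by apply/sumsP; exists a1, x; rewrite !inE eqxx addmC.
exists t => b bB.
have [N] := ubnP (count (fun x => b < x)%O B).
elim: N b bB => // N IH b bB; rewrite ltnS => szN.
have [->|bt] := eqVneq b t; first by exists 0%N; rewrite mulr0n subr0.
have [b' b'B e] := step _ bB bt.
have bb' : (b < b')%O.
  rewrite ltNge; apply/negP => b'b.
  have : ((a1 + b')%MM < (a2 + b)%MM)%O by apply: ltmc_le_add.
  by rewrite addmC -e addmC ltxx.
have [|m mE] := IH b' b'B.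
  apply: leq_trans szN; rewrite -!size_filter.
  suff : (size (b' :: [seq x <- B | (b' < x)%O]) <= size [seq x <- B | (b < x)%O])%N by [].
  apply: uniq_leq_size => [|x]; first by rewrite /= mem_filter ltxx filter_uniq.
  rewrite inE !mem_filter => /predU1P[->|/andP[b'x ->]]; first by rewrite bb'.
  by rewrite (lt_trans bb' b'x).
exists m.+1; have := congr1 zvec e; rewrite !zvecD mE => /(canRL (addrK _)) ->.
by rewrite mulrSr opprD opprB !addrA.
Qed.

Lemma size_sums_ge A B : A != [::] -> B != [::] -> uniq A -> uniq B ->
  (size A + size B <= (size (sums A B)).+1)%N.
Proof.
move=> A0 B0 uA uB; pose A' := sort <=%O A.
have AA : A =i A' by move=> x; rewrite mem_sort.
have sA : sorted <%O A' by rewrite sort_lt_sorted.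
have szA : size A' = size A by rewrite size_sort.
rewrite (size_sums_perm _ AA) -szA.
case: A' sA szA {AA} => [|a A'] sA szA; first by case: A A0 szA {uA}.
have := @size_sums_sorted [:: a] A' B B0 sA; rewrite /= addSn ltnS; apply: leq_trans.
rewrite addnC leq_add2r -(size_map (mnm_add a)).
apply: uniq_leq_size; first by rewrite map_inj_uniq //; exact: addmI.
by move=> _ /mapP[b bB ->]; apply/sumsP; exists a, b; rewrite mem_head.
Qed.

(** Adding the elements of [A] in increasing order brings at least one new sum each. Hence the two
    smallest, [a1] and [a2], form at most [size B + 1] sums with [B], and [size_sums_pair]
    applies. *)
Lemma sums_progression A B : (1 < size A)%N -> uniq A -> uniq B ->
  (size (sums A B) < size A + size B)%N ->
  exists (t : 'X_{1..n}) (a1 a2 : 'X_{1..n}), [/\ a1 \in A, a2 \in A, a1 != a2 &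
    forall b, b \in B -> exists m : nat, zvec b = zvec t - (zvec a2 - zvec a1) *+ m].
Proof.
move=> szA1 uA uB; pose A' := sort <=%O A.
have AA : A =i A' by move=> x; rewrite mem_sort.
have sA : sorted <%O A' by rewrite sort_lt_sorted.
have szA : size A' = size A by rewrite size_sort.
rewrite (size_sums_perm _ AA) -szA.
case: A' sA szA AA => [|a1 [|a2 A']] sA szA AA szAB; try by rewrite -szA in szA1.
have a12 : (a1 < a2)%O by case/andP: sA.
have [t tP] : exists t, forall b, b \in B ->
    exists m : nat, zvec b = zvec t - (zvec a2 - zvec a1) *+ m.
  have [->|B0] := eqVneq B [::]; first by exists 0%MM.
  apply: size_sums_pair => //.
  have := @size_sums_sorted [:: a1; a2] A' B B0 sA => /leq_ltn_trans/(_ szAB).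
  by rewrite /= addnC !addSnnS ltn_add2l ltnS.
by exists t, a1, a2; split=> //; rewrite ?AA ?inE ?eqxx ?orbT ?lt_eqF.
Qed.

(* The equality case of [size_sums_ge]: both sets are arithmetic progressions
   with the same difference. *)
Lemma sums_collinear A B : (1 < size A)%N -> (1 < size B)%N -> uniq A -> uniq B ->
  (size (sums A B) < size A + size B)%N ->
  exists o d : 'rV[int]_n, forall m, m \in sums A B ->
    exists z : int, zvec m = o + d *~ z.
Proof.
move=> A1 B1 uA uB szAB.
have [t [a1 [a2 [a1A a2A _ tP]]]] := sums_progression A1 uA uB szAB.
have [|t' [b1 [b2 [b1B b2B _ tP']]]] := sums_progression B1 uB uA _.
  by rewrite size_sumsC addnC.
have [[m1 m1E] [m2 m2E]] := (tP _ b1B, tP _ b2B).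
(* [b1] and [b2] lie in the progression of difference [d] that contains [B], so the difference of
   the progression containing [A] is an integer multiple of [d]. *)
pose d := zvec a2 - zvec a1.
exists (zvec t + zvec t'), d => _ /sumsP[a [b [/tP'[m' aE] /tP[m bE] ->]]].
exists (- (m%:Z + (m1%:Z - m2%:Z) * m'%:Z)).
have dE : zvec b2 - zvec b1 = d *~ (m1%:Z - m2%:Z).
  by rewrite m1E m2E -/d mulrzBr -!pmulrn opprB addrC addrA subrK.
by rewrite zvecD aE bE dE -/d mulrNz [in RHS]mulrzDr mulrzA -!pmulrn addrACA -opprD
  [zvec t' + _]addrC [d *~ _ *+ _ + _]addrC.
Qed.

End Sumsets.

(** * Generic minors *)

Section BorderedDet.
Variables (A : comNzRingType) (p : nat).
Implicit Types (X : 'I_p -> 'I_p.+1 -> A) (r : 'I_p.+1 -> A).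

Definition bordered X r : 'M[A]_p.+1 :=
  \matrix_(a, b) if unlift ord_max a is Some i then X i b else r b.

(* the signed maximal minors of [X] *)
Definition minor X (j : 'I_p.+1) : A := \det (bordered X (fun b => (b == j)%:R)).

Lemma det_bordered X r : \det (bordered X r) = \sum_j r j * minor X j.
Proof.
have cof r' j : cofactor (bordered X r) ord_max j = cofactor (bordered X r') ord_max j.
  rewrite /cofactor; congr (_ * \det _); apply/matrixP => a b.
  by rewrite !mxE liftK.
rewrite (expand_det_row _ ord_max); apply: eq_bigr => j _.
rewrite mxE unlift_none /minor (expand_det_row _ ord_max) (bigD1 j) //= big1.
  by rewrite !mxE unlift_none eqxx mul1r addr0 (cof (fun b => (b == j)%:R)).
by move=> b bj; rewrite !mxE unlift_none (negPf bj) mul0r.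
Qed.

Lemma minor_alternate X i l j : i != l -> X i =1 X l -> minor X j = 0.
Proof.
move=> il Xil; apply: (determinant_alternate (i1 := fintype.lift ord_max i)
  (i2 := fintype.lift ord_max l)).
  by rewrite (inj_eq (@lift_inj _ _)).
by move=> b; rewrite !mxE !liftK.
Qed.

Lemma lift_ord_max (i : 'I_p) : fintype.lift ord_max i = widen_ord (leqnSn p) i.
Proof. by apply: val_inj; rewrite /= /bump leqNgt ltn_ord. Qed.

Lemma minorE X j : minor X j = \sum_(s : 'S_p.+1 | s ord_max == j)
  (-1) ^+ s * \prod_i X i (s (widen_ord (leqnSn p) i)).
Proof.
rewrite [RHS]big_mkcond; apply: eq_bigr => s _.
rewrite big_ord_recr /= !mxE unlift_none.
under eq_bigr do rewrite -lift_ord_max !mxE liftK lift_ord_max.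
by case: eqP => _; rewrite ?mulr1 ?mulr0.
Qed.

End BorderedDet.

Lemma rmorph_minor (A B : comNzRingType) (phi : {rmorphism A -> B}) p
    (X : 'I_p -> 'I_p.+1 -> A) j :
  phi (minor X j) = minor (fun i b => phi (X i b)) j.
Proof.
rewrite /minor -det_map_mx; congr (\det _); apply/matrixP => a b; rewrite !mxE.
by case: unlift => //; rewrite rmorph_nat.
Qed.

Lemma det_ker0 (R : idomainType) m (M : 'M[R]_m) (v : 'I_m -> R) b :
  (forall a, \sum_c M a c * v c = 0) -> v b != 0 -> \det M = 0.
Proof.
move=> Mv vb; have /(congr1 (fun w : 'cV_m => w b 0)) : \adj M *m (M *m \col_c v c) = 0.
  suff -> : M *m \col_c v c = 0 by rewrite mulmx0.
  apply/matrixP => a c; rewrite !mxE -[RHS](Mv a).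
  by apply: eq_bigr => c' _; rewrite mxE.
rewrite mulmxA mul_adj_mx mul_scalar_mx !mxE => /eqP.
by rewrite mulf_eq0 (negPf vb) orbF => /eqP.
Qed.

(** The row [r], with [F i] in column [j] and [- F j] in column [i], is orthogonal to [F]. So [X]
    bordered by [r] kills [F] and has determinant zero if [F] is nonzero; expanding along [r] gives
    the difference of the two sides. *)
Lemma ker_minor (R : idomainType) p (X : 'I_p -> 'I_p.+1 -> R) (F : 'I_p.+1 -> R) :
  (forall i, \sum_b X i b * F b = 0) ->
  forall i j, F i * minor X j = F j * minor X i.
Proof.
move=> XF i j; have [F0|] := pselect (forall b, F b = 0); first by rewrite !F0 !mul0r.
move=> /existsNP[b0 /eqP Fb0].
pose r b := F i * (b == j)%:R - F j * (b == i)%:R.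
have sumD (G : 'I_p.+1 -> R) : \sum_b r b * G b = F i * G j - F j * G i.
  under eq_bigr do rewrite mulrBl.
  rewrite big_split /= sumrN; congr (_ - _).
    rewrite (bigD1 j) //= big1 ?eqxx ?mulr1 ?addr0 // => b /negPf ->.
    by rewrite mulr0 mul0r.
  rewrite (bigD1 i) //= big1 ?eqxx ?mulr1 ?addr0 // => b /negPf ->.
  by rewrite mulr0 mul0r.
apply/eqP; rewrite -subr_eq0 -sumD -det_bordered; apply/eqP.
apply: (det_ker0 (v := F) (b := b0)) => // a.
under eq_bigr do rewrite mxE.
by case: unliftP => [i' _|_] //; rewrite sumD mulrC subrr.
Qed.

(** * Polynomials in blocks of variables *)

Section Blocks.
Variables (k : fieldType) (p n : nat).

(* Variables are indexed by the pairs (block, coordinate). *)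
Local Notation N := #|{: 'I_p * 'I_n}|.
Local Notation R := {mpoly k[N]}.
Implicit Types (e : 'I_p -> 'X_{1..n}) (m : 'X_{1..N}) (P : 'X_{1..n}).

Definition block (i : 'I_p) m : 'X_{1..n} := [multinom m (enum_rank (i, c)) | c < n].

Definition glue e : 'X_{1..N} := [multinom e (enum_val a).1 (enum_val a).2 | a < N].

Definition glue1 (i : 'I_p) P : 'X_{1..N} := glue (fun l => if l == i then P else 0%MM).

Definition unblock (i : 'I_p) m : 'X_{1..N} :=
  glue (fun l => if l == i then 0%MM else block l m).

Lemma block_glue i e : block i (glue e) = e i.
Proof. by apply/mnmP => c; rewrite !mnmE enum_rankK. Qed.

Lemma glue_block m : glue (block^~ m) = m.
Proof.
apply/mnmP => a; rewrite !mnmE; congr (m _).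
by rewrite -[RHS]enum_valK; case: (enum_val a).
Qed.

Lemma blockP m m' : (forall i, block i m = block i m') -> m = m'.
Proof.
move=> e; rewrite -(glue_block m) -(glue_block m').
by apply/mnmP => a; rewrite !mnmE -!(mnmE (fun c => _ (enum_rank (_, c)))) -/(block _ _) e.
Qed.

Lemma blockD i m m' : block i (m + m')%MM = (block i m + block i m')%MM.
Proof. by apply/mnmP => c; rewrite !mnmE. Qed.

Lemma block_sum (I : Type) (r : seq I) (F : I -> 'X_{1..N}) i :
  block i (\sum_(a <- r) F a)%MM = (\sum_(a <- r) block i (F a))%MM.
Proof.
by apply: (big_morph (block i) (blockD i)); apply/mnmP => c; rewrite !mnmE.
Qed.

Lemma block_glue1 i l P : block l (glue1 i P) = if l == i then P else 0%MM.
Proof. exact: block_glue. Qed.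

Lemma glue_sum e : (\sum_i glue1 i (e i))%MM = glue e.
Proof.
apply: blockP => l; rewrite block_sum block_glue (bigD1 l) //= block_glue1 eqxx.
rewrite big1 ?addm0 // => i il; rewrite block_glue1 eq_sym (negPf il) //.
Qed.

Lemma glueD e e' : glue (fun i => e i + e' i)%MM = (glue e + glue e')%MM.
Proof. by apply: blockP => i; rewrite blockD !block_glue. Qed.

Lemma unblockK i m : (unblock i m + glue1 i (block i m))%MM = m.
Proof.
apply: blockP => l; rewrite blockD !block_glue.
by case: eqP => [->|_]; rewrite ?add0m ?addm0.
Qed.

(** The generic point with the variables of block [l] as coordinates. After [theta i], evaluation at
    it substitutes block [l] for block [i]. *)
Definition pt (l : 'I_p) (c : 'I_n) : R := 'X_(enum_rank (l, c)).

Lemma prod_pt l P : \prod_(c < n) pt l c ^+ P c = 'X_[k, glue1 l P].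
Proof.
rewrite /pt; under eq_bigr do rewrite mpolyXn.
rewrite mprodXE; congr 'X_[_]; apply/mnmP => a; rewrite mnm_sumE mnmE.
case Ea: (enum_val a) => [l' c'] /=.
have aE : a = enum_rank (l', c') by rewrite -Ea enum_valK.
case: eqP => [ll|ne].
  rewrite (bigD1 c') //= big1 ?addn0.
    by rewrite mulmnE mnm1E aE ll eqxx mul1n.
  move=> c cc; rewrite mulmnE mnm1E aE (inj_eq enum_rank_inj) xpair_eqE.
  by rewrite (negPf cc) andbF.
rewrite mnm0E big1 // => c _; rewrite mulmnE mnm1E aE (inj_eq enum_rank_inj).
by rewrite xpair_eqE eq_sym; case: eqP.
Qed.

Lemma meval_pt l P : ('X_[P] : {mpoly R[n]}).@[pt l] = 'X_[glue1 l P].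
Proof. by rewrite mevalX prod_pt. Qed.

(** Different permutations contribute different monomials, since that of [s] has the exponent
    [P (s a)] in block [l a]; so the monomial of the identity has coefficient 1. *)
Lemma det_glue1_neq0 r (l : 'I_r -> 'I_p) (P : 'I_r -> 'X_{1..n}) :
  injective l -> injective P ->
  \det (\matrix_(a < r, b < r) ('X_[glue1 (l a) (P b)] : R)) != 0.
Proof.
move=> lI PI; pose M (s : 'S_r) := (\sum_(a < r) glue1 (l a) (P (s a)))%MM.
have blockM s a : block (l a) (M s) = P (s a).
  rewrite block_sum (bigD1 a) //= block_glue1 eqxx big1 ?addm0 // => b ba.
  by rewrite block_glue1 (inj_eq lI) eq_sym (negPf ba).
have : (\det (\matrix_(a < r, b < r) ('X_[glue1 (l a) (P b)] : R)))@_(M 1%g) = 1.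
  rewrite raddf_sum /= (bigD1 1%g) //= [X in _ + X]big1 ?addr0.
    under eq_bigr do rewrite mxE.
    by rewrite mprodXE odd_perm1 expr0 mul1r mcoeffX eqxx.
  move=> s s1; under eq_bigr do rewrite mxE.
  rewrite mprodXE mulr_sign; case: ifP => _; rewrite ?mcoeffN mcoeffX -/(M s).
    case: eqP => [e|]; last by rewrite oppr0.
    case/eqP: s1; apply/permP => a; apply: PI.
    by rewrite -!blockM e.
  case: eqP => // e; case/eqP: s1; apply/permP => a; apply: PI.
  by rewrite -!blockM e.
by apply: contra_eq_neq => ->; rewrite mcoeff0 eq_sym oner_eq0.
Qed.

(* Generic points impose independent conditions. *)
Lemma meval_pt_neq0 (f : {mpoly R[n]}) (L : seq 'I_p) : f != 0 -> uniq L ->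
  (size (msupp f) <= size L)%N -> exists2 l, l \in L & f.@[pt l] != 0.
Proof.
move=> f0 uL szL; apply/exists2P; apply: contrapT => nex.
have fL l : l \in L -> f.@[pt l] = 0.
  move=> lL; apply/eqP; apply: contrapT => /negP fl; apply: nex.
  by exists l.
have sz0 : (0 < size (msupp f))%N by rewrite lt0n size_eq0 msupp_eq0.
have [l0 _] : exists l0, l0 \in L.
  by case: (L) szL => [|l0 L'] /=; [rewrite leqNgt sz0 | exists l0; rewrite mem_head].
pose l (a : 'I_(size (msupp f))) := nth l0 L a.
pose P (b : 'I_(size (msupp f))) := nth 0%MM (msupp f) b.
have aL (a : 'I_(size (msupp f))) : (a < size L)%N := leq_trans (ltn_ord a) szL.
have /negP[] : \det (\matrix_(a, b) ('X_[glue1 (l a) (P b)] : R)) != 0.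
  apply: det_glue1_neq0 => a b /eqP.
    by rewrite nth_uniq // => /eqP/val_inj.
  by rewrite nth_uniq ?msupp_uniq // => /eqP/val_inj.
apply/eqP; apply: (det_ker0 (v := fun b => f@_(P b)) (b := Ordinal sz0)); last first.
  by rewrite -mcoeff_msupp mem_nth.
move=> a; rewrite -[RHS](fL (l a)) ?mem_nth // mevalE (big_nth 0%MM) big_mkord.
by apply: eq_bigr => b _; rewrite mxE mulrC -prod_pt.
Qed.

Definition theta_var (i : 'I_p) (a : 'I_N) : {mpoly R[n]} :=
  if (enum_val a).1 == i then 'X_((enum_val a).2) else ('X_a)%:MP.

(* The ring [R] is seen as a polynomial ring in the variables of the block
   [i], now denoted by new variables. *)
Definition theta (i : 'I_p) : R -> {mpoly R[n]} :=
  mmap (@mpolyC n R \o @mpolyC N k) (theta_var i).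
HB.instance Definition _ i := GRing.RMorphism.on (theta i).

Lemma thetaX i m : theta i 'X_[m] = ('X_[unblock i m])%:MP * 'X_[block i m].
Proof.
rewrite /theta mmapX /mmap1 (bigID (fun a : 'I_N => (enum_val a).1 == i)) /= mulrC.
congr (_ * _).
  rewrite [X in X%:MP]mpolyXE_id rmorph_prod /= [LHS]big_mkcond /=; apply: eq_bigr => a _.
  rewrite rmorphXn /= /theta_var !mnmE.
  case: eqP => _ /=; first by rewrite mnm0E expr0.
  by rewrite mnmE -surjective_pairing enum_valK.
rewrite mpolyXE_id (reindex_onto (fun c => enum_rank (i, c)) (fun a => (enum_val a).2)) /=.
  apply: eq_big => [c|c _]; first by rewrite enum_rankK !eqxx.
  by rewrite /theta_var enum_rankK eqxx mnmE.
by move=> a /eqP <-; rewrite -surjective_pairing enum_valK.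
Qed.

Lemma theta_glue1 i l P : theta i 'X_[glue1 l P] =
  if l == i then 'X_[P] else ('X_[glue1 l P])%:MP.
Proof.
rewrite thetaX block_glue1 eq_sym; case: eqP => [->|/eqP il].
  suff -> : unblock i (glue1 i P) = 0%MM by rewrite mpolyX0 mul1r.
  apply: blockP => j; rewrite /unblock block_glue block_glue1.
  by apply/mnmP => c; case: eqP => _; rewrite !mnmE.
rewrite mpolyX0 mulr1; congr ('X_[_])%:MP; apply: blockP => j.
rewrite /unblock block_glue; case: eqP => [->|//].
by rewrite block_glue1 eq_sym (negPf il).
Qed.

Lemma theta_sum i (f : R) :
  theta i f = \sum_(m <- msupp f) (f@_m *: 'X_[unblock i m]) *: 'X_[block i m].
Proof.
rewrite {1}(mpolyE f) raddf_sum /=; apply: eq_bigr => m _.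
rewrite -!mul_mpolyC rmorphM /= thetaX mulrA; congr (_ * _).
by rewrite /theta mmapC /= -mpolyCM.
Qed.

Lemma mcoeff_theta i (f : R) m : (theta i f)@_(block i m)@_(unblock i m) = f@_m.
Proof.
rewrite theta_sum !raddf_sum /= [in RHS](mpolyE f) raddf_sum /=; apply: eq_bigr => m' _.
rewrite !mcoeffZ mcoeffX mcoeffX; have [->|ne] := eqVneq m' m.
  by rewrite !eqxx mulr1 mcoeffZ mcoeffX eqxx.
case: eqP => [e|_]; last by rewrite mulr0 mcoeff0 mulr0.
rewrite mulr1 mcoeffZ mcoeffX; case: eqP => // e'; case/eqP: ne.
by rewrite -(unblockK i m') -(unblockK i m) e e'.
Qed.

Lemma msupp_theta i (f : R) m : m \in msupp f -> block i m \in msupp (theta i f).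
Proof.
rewrite !mcoeff_msupp -(mcoeff_theta i).
by apply: contraNneq => ->; rewrite mcoeff0.
Qed.

Lemma msupp_thetaP i (f : R) P :
  P \in msupp (theta i f) -> exists2 m, m \in msupp f & block i m = P.
Proof.
move=> Pf; apply/exists2P; apply: contrapT => nex.
move: Pf; rewrite mcoeff_msupp theta_sum raddf_sum /= big_seq big1 ?eqxx // => m mf.
rewrite mcoeffZ mcoeffX; case: eqP => [e|]; last by rewrite mulr0.
by case: nex; exists m.
Qed.

End Blocks.

(** * The minors of the generic matrix and their supports *)

Section GenericMinors.
Variables (k : fieldType) (p n : nat) (q : 'I_p.+1 -> 'X_{1..n}).
Hypothesis q_inj : injective q.

Local Notation N := #|{: 'I_p * 'I_n}|.
Local Notation R := {mpoly k[N]}.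

Definition gen_row (i : 'I_p) (b : 'I_p.+1) : R := 'X_[glue1 i (q b)].
Definition gen_minor (j : 'I_p.+1) : R := minor gen_row j.

Definition perm_mon (s : 'S_p.+1) : 'X_{1..N} :=
  glue (fun i => q (s (widen_ord (leqnSn p) i))).

Lemma gen_minorE j :
  gen_minor j = \sum_(s : 'S_p.+1 | s ord_max == j) (-1) ^+ s *: 'X_[perm_mon s].
Proof.
rewrite /gen_minor minorE; apply: eq_bigr => s _.
rewrite mprodXE glue_sum -mul_mpolyC; congr (_ * _).
by rewrite rmorphXn rmorphN rmorph1.
Qed.

Lemma perm_mon_inj j : {in [pred s : 'S_p.+1 | s ord_max == j] &, injective perm_mon}.
Proof.
move=> s t /eqP sj /eqP tj st; apply/permP => a.
case: (unliftP ord_max a) => [i ->|->]; last by rewrite sj tj.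
have := congr1 (block i) st; rewrite !block_glue => /q_inj.
by rewrite lift_ord_max.
Qed.

Lemma mcoeff_gen_minor (s : 'S_p.+1) :
  (gen_minor (s ord_max))@_(perm_mon s) = (-1) ^+ s.
Proof.
rewrite gen_minorE raddf_sum (bigD1 s) //= big1 ?addr0.
  by rewrite mcoeffZ mcoeffX eqxx mulr1.
move=> t /andP[tj ts]; rewrite mcoeffZ mcoeffX; case: eqP => [|_]; last by rewrite mulr0.
by move/(perm_mon_inj tj) => /(_ (eqxx _)) e; rewrite e eqxx in ts.
Qed.

Lemma gen_minor_neq0 : gen_minor ord_max != 0.
Proof.
have e := mcoeff_gen_minor 1%g; rewrite perm1 odd_perm1 expr0 in e.
by apply: contra_eq_neq e => ->; rewrite mcoeff0 eq_sym oner_eq0.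
Qed.

Lemma msupp_gen_minor i j l : l != j ->
  exists2 m, m \in msupp (gen_minor j) & block i m = q l.
Proof.
move=> lj; pose i1 := tperm ord_max j (widen_ord (leqnSn p) i).
have ij : i1 != j.
  rewrite -[j in X in _ != X](tpermL ord_max) (inj_eq perm_inj).
  by rewrite -lift_ord_max eq_sym neq_lift.
(* [s] sends [ord_max] to [j] and slot [i] to [l]: the first transposition moves the slot to [i1],
   the second takes [i1] to [l] and fixes [j]. *)
pose s := (tperm ord_max j * tperm i1 l)%g.
have sj : s ord_max = j by rewrite permM tpermL tpermD // eq_sym.
exists (perm_mon s); last by rewrite block_glue permM tpermL.
by rewrite mcoeff_msupp -sj mcoeff_gen_minor signr_eq0.
Qed.

Lemma msupp_gen_minorP i j m : m \in msupp (gen_minor j) ->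
  exists2 l, l != j & block i m = q l.
Proof.
move=> mj; apply/exists2P; apply: contrapT => nex.
move: mj; rewrite mcoeff_msupp gen_minorE raddf_sum big1 ?eqxx // => s /eqP sj /=.
rewrite mcoeffZ mcoeffX; case: eqP => [e|_]; last by rewrite mulr0.
case: nex; exists (s (widen_ord (leqnSn p) i)); split; last by rewrite -e block_glue.
by rewrite -sj (inj_eq perm_inj) -lift_ord_max eq_sym neq_lift.
Qed.

Lemma theta_minor_neq0 i j l : l != j -> (theta i (gen_minor j))@_(q l) != 0.
Proof.
move=> /(msupp_gen_minor i)[m mj <-]; rewrite -mcoeff_msupp; exact: msupp_theta.
Qed.

Lemma theta_minor_eq0 i j : (theta i (gen_minor j))@_(q j) = 0.
Proof.
apply/eqP; rewrite mcoeff_eq0; apply/negP => /msupp_thetaP[m /(msupp_gen_minorP i)].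
by move=> [l lj ->] /q_inj/eqP; rewrite (negPf lj).
Qed.

(** Substituting block [l] for block [i] makes two rows equal. *)
Lemma meval_theta_minor i l j : i != l -> (theta i (gen_minor j)).@[pt k l] = 0.
Proof.
move=> il; pose phi : {rmorphism R -> R} := meval (pt k l) \o theta i.
rewrite -[LHS]/(phi (gen_minor j)) rmorph_minor; apply: (@minor_alternate _ _ _ i l j il) => b.
rewrite /= /gen_row !theta_glue1 eqxx eq_sym (negPf il) meval_pt.
by rewrite mevalC.
Qed.

(* Fewer coefficients would force the polynomials [G j], which vanish at the
   points of [L], to be proportional. *)
Lemma cofactors_size (H : {mpoly R[n]}) (G D : 'I_p.+1 -> {mpoly R[n]})
    (L : seq 'I_p) (B : seq 'X_{1..n}) :
  (forall j, D j = H * G j) -> (0 < p)%N ->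
  (forall j, (D j)@_(q j) = 0) -> (forall j l, l != j -> (D j)@_(q l) != 0) ->
  uniq L -> (forall t, t \in L -> H.@[pt k t] != 0) ->
  (forall t j, t \in L -> (D j).@[pt k t] = 0) ->
  (forall P, reflect (exists j, P \in msupp (G j)) (P \in B)) ->
  (size L + 2 <= size B)%N.
Proof.
move=> DE p0 Dq0 Dq uL HL DL memB; rewrite leqNgt; apply/negP => szB.
have neqj j : exists l : 'I_p.+1, l != j.
  have [->|ne] := eqVneq j ord_max; last by exists ord_max; rewrite eq_sym.
  by exists ord0; rewrite -val_eqE /= eq_sym -lt0n.
have G0 j : G j != 0.
  have [l lj] := neqj j; have := Dq _ _ lj.
  by apply: contraNneq => g0; rewrite DE g0 mulr0 mcoeff0.
pose j0 : 'I_p.+1 := ord0; pose P0 := mlead (G j0).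
have P0j0 : P0 \in msupp (G j0) := mlead_supp (G0 j0).
have [l lj0] := neqj j0.
(* [w] cancels the monomial [P0], so it has at most [size L] monomials, all from [B]. As it vanishes
   at the points of [L], it is zero. *)
pose w := (G l)@_P0 *: G j0 - (G j0)@_P0 *: G l.
have wP0 : w@_P0 = 0 by rewrite /w mcoeffB !mcoeffZ mulrC subrr.
have wB : {subset msupp w <= filter (predC1 P0) B}.
  move=> P Pw; rewrite mem_filter /=; apply/andP; split.
    by apply: contraTneq Pw => ->; rewrite mcoeff_msupp wP0 eqxx.
  move: (msuppB_le Pw); rewrite mem_cat => /orP[] /msuppZ_le Pg; apply/memB.
    by exists j0.
  by exists l.
have w0 : w = 0.
  apply/eqP; apply: contraT => w0.
  have [|t tL] := @meval_pt_neq0 k p n w L w0 uL.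
    apply: leq_trans (uniq_leq_size (msupp_uniq _) wB) _.
    have P0B : P0 \in B by apply/memB; exists j0.
    have := count_predC (pred1 P0) B; rewrite -[count (predC _) _]size_filter.
    move=> szE; move: szB; rewrite -szE addn2 ltnS => szB.
    by rewrite -ltnS; apply: leq_trans szB; rewrite -add1n leq_add2r -has_count has_pred1.
  have gt0 j : (G j).@[pt k t] = 0.
    have := DL t j tL; rewrite DE mevalM => /eqP.
    by rewrite mulf_eq0 (negPf (HL _ tL)) => /eqP.
  by rewrite /w mevalB !mevalZ !gt0 !mulr0 subrr eqxx.
have prop : (G l)@_P0 *: D j0 = (G j0)@_P0 *: D l.
  apply/eqP; rewrite -subr_eq0 !DE; apply/eqP.
  transitivity (H * w); last by rewrite w0 mulr0.
  by rewrite /w mulrBr; congr (_ - _); rewrite -scalerAr.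
have := congr1 (mcoeff (q l)) prop.
rewrite !mcoeffZ Dq0 mulr0 => /eqP.
rewrite mulf_eq0 (negPf (Dq _ _ lj0)) orbF => /eqP gl0.
(* [q j0] is absent from [D j0] but present in [D l], so its coefficient forces that of [G j0] at
   [P0] to vanish. *)
have := congr1 (mcoeff (q j0)) prop.
rewrite !mcoeffZ Dq0 mulr0 => /esym/eqP.
rewrite mulf_eq0 (negPf (Dq l j0 _)) ?orbF; last by rewrite eq_sym.
by move: P0j0; rewrite mcoeff_msupp => /negPf ->.
Qed.

(** * Common factors of the generic minors *)

Section CommonFactor.
Variables (K : realType) (C : set 'rV[K]_n).
Hypothesis C_convex : convex C.
Hypothesis qC : forall b, C (mvec K (q b)).
Hypothesis Cq : forall P, C (mvec K P) -> exists b, P = q b.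
Hypothesis q_line : ~ exists o d : 'rV[int]_n, forall b, exists z : int,
  zvec (q b) = o + d *~ z.

Variables (h : R) (g : 'I_p.+1 -> R).
Hypothesis hg : forall j, gen_minor j = h * g j.

Lemma theta_hg i j : theta i (gen_minor j) = theta i h * theta i (g j).
Proof. by rewrite hg rmorphM. Qed.

Lemma theta_h_neq0 i : theta i h != 0.
Proof.
have ne : ord_max != fintype.lift ord_max i by rewrite neq_lift.
have := theta_minor_neq0 i ne; apply: contraNneq => h0.
by rewrite theta_hg h0 mul0r mcoeff0.
Qed.

(** The [p - 1] blocks other than [i] split into [L1], where [theta i h] vanishes, and [L2], where
    the cofactors do. Then [size L1 + 1] and [size L2 + 2] bound the sizes of [A] and [B] from
    below, which add up to at least [p + 2], while there are at most [p + 1] sums. If [A] had two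
    elements, [sums_collinear] would put all the sums on a line. *)
Lemma size_msupp_theta_h i : size (msupp (theta i h)) = 1%N.
Proof.
apply/eqP; rewrite eqn_leq lt0n size_eq0 msupp_eq0 theta_h_neq0 andbT leqNgt.
apply/negP => szA; set A := msupp (theta i h) in szA.
pose B := undup (flatten [seq msupp (theta i (g j)) | j <- enum 'I_p.+1]).
have memB P : reflect (exists j, P \in msupp (theta i (g j))) (P \in B).
  rewrite mem_undup; apply: (iffP flatten_mapP) => [[j _ Pj]|[j Pj]]; exists j => //.
  by rewrite mem_enum.
have ABq P : P \in sums A B -> exists b, P = q b.
  case/sumsP => a [b [aA /memB[j bj] ->]]; apply: Cq.
  apply: (msuppM_convex C_convex _ aA bj) => m.
  rewrite -theta_hg => /msupp_thetaP[m' /(msupp_gen_minorP i)[l _ e] <-]; rewrite e.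
  exact: qC.
have szAB : (size (sums A B) <= p.+1)%N.
  rewrite -[p.+1]card_ord -(size_codom q); apply: uniq_leq_size; first exact: undup_uniq.
  by move=> P /ABq[b ->]; exact: codom_f.
pose L := filter (predC1 i) (enum 'I_p).
pose L1 := [seq l <- L | (theta i h).@[pt k l] == 0].
pose L2 := [seq l <- L | (theta i h).@[pt k l] != 0].
have uL : uniq L by rewrite filter_uniq // enum_uniq.
have iL l : l \in L -> i != l by rewrite mem_filter /= eq_sym => /andP[].
have szL : (size L1 + size L2)%N = p.-1.
  rewrite 2!size_filter count_predC.
  have := count_predC (pred1 i) (enum 'I_p).
  rewrite -[count (predC _) _]size_filter -/L.
  rewrite (count_uniq_mem _ (enum_uniq _)) mem_enum size_enum_ord add1n.
  by move=> /(congr1 predn).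
have szA1 : (size L1 < size A)%N.
  rewrite ltnNge; apply/negP => /(meval_pt_neq0 (theta_h_neq0 i)) [].
    exact: filter_uniq.
  by move=> l; rewrite mem_filter => /andP[-> _].
have p0 : (0 < p)%N := leq_ltn_trans (leq0n i) (ltn_ord i).
have szB2 : (size L2 + 2 <= size B)%N.
  apply: (cofactors_size (theta_hg i)) => //.
  - exact: theta_minor_eq0.
  - by move=> j l; exact: theta_minor_neq0.
  - exact: filter_uniq.
  - by move=> t; rewrite mem_filter => /andP[].
  - move=> t j; rewrite mem_filter => /andP[_ tL].
    by apply: meval_theta_minor; exact: iL.
have uA : uniq A by exact: msupp_uniq.
have uB : uniq B by exact: undup_uniq.
have szB : (1 < size B)%N by apply: leq_trans szB2; rewrite addn2.
have szAB' : (p.+2 <= size A + size B)%N.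
  apply: leq_trans (leq_add szA1 szB2); rewrite addSn addnA szL addn2 prednK //.
have [o [d od]] := sums_collinear szA szB uA uB (leq_ltn_trans szAB szAB').
apply: q_line; exists o, d => b; apply: od.
have AB0 : A != [::] /\ B != [::] by rewrite -!size_eq0 -!lt0n; split; exact: ltnW.
(* There are also at least [p + 1] sums, so they exhaust the points [q b]. *)
have szge := size_sums_ge AB0.1 AB0.2 uA uB.
have sub : {subset sums A B <= codom q} by move=> P /ABq[b' ->]; exact: codom_f.
have [|_ e] := uniq_min_size (undup_uniq _) sub.
  by rewrite size_codom card_ord -ltnS; apply: leq_trans szge.
by rewrite e codom_f.
Qed.

Lemma common_factor_monomial : exists2 m, h@_m != 0 & h = h@_m *: 'X_[m].
Proof.
have h0 : h != 0.
  by have := gen_minor_neq0; apply: contraNneq => h0; rewrite hg h0 mul0r.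
have mh := mlead_supp h0; set m := mlead h in mh.
exists m; first by rewrite -mcoeff_msupp.
apply/mpolyP => m'; rewrite mcoeffZ mcoeffX; have [<-|ne] := eqVneq m m'.
  by rewrite mulr1.
rewrite mulr0; apply/eqP; rewrite mcoeff_eq0; apply/negP => m'h; case/eqP: ne.
apply: blockP => i; have := size_msupp_theta_h i.
case: (msupp _) (msupp_theta i mh) (msupp_theta i m'h) => [|P [|]] //.
by rewrite !inE => /eqP -> /eqP ->.
Qed.

End CommonFactor.
End GenericMinors.

(** * Tensors as tuples of polynomials *)

Section FreeModule.
Variables (k : fieldType) (V : lmodType k) (I : choiceType).

Lemma fgliftE (f : I -> V) (D : {freeg I / k}) :
  fglift f D = \sum_(z <- dom D) coeff z D *: f z.
Proof.
rewrite -{1}(freeg_sumE D) raddf_sum /=; apply: eq_bigr => z _.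
exact: liftU.
Qed.

(** Both basis statements are proved by showing that the linear map [fglift b] on the free module is
    injective with image [U]. *)
Lemma is_basis_fglift (b : I -> V) (U : set V) :
  (forall D, fglift b D = 0 -> D = 0) ->
  (forall D, U (fglift b D)) -> (forall v, U v -> exists D, v = fglift b D) ->
  is_basis b U.
Proof.
move=> b_inj bU Ub; split=> [s c us sum0 i si|].
  pose D : {freeg I / k} := \sum_(j <- s) [freeg [:: (c j, j)]].
  have D0 : D = 0.
    apply: b_inj; rewrite /D raddf_sum -[RHS]sum0; apply: eq_bigr => j _.
    exact: liftU.
  have : coeff i D = c i.
    rewrite /D raddf_sum /= (bigD1_seq i) //= coeffU eqxx mulr1 big1 ?addr0 // => j ji.
    by rewrite coeffU (negPf ji) mulr0.
  by rewrite D0 coeff0.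
apply/seteqP; split=> v /=.
  move=> /spanpP[s [sb ->]].
  suff [D ->] : exists D, \sum_(x <- s) x.1 *: x.2 = fglift b D by exact: bU.
  elim: s sb => [|x s IH] sb; first by exists 0; rewrite big_nil raddf0.
  have [|D DE] := IH; first by move=> y ys; apply: sb; rewrite inE ys orbT.
  have [i _ xE] := sb x (mem_head _ _).
  exists ([freeg [:: (x.1, i)]] + D).
  by rewrite big_cons DE raddfD /= -xE; congr (_ + _); rewrite liftU.
move=> /Ub[D ->]; apply/spanpP; exists [seq (coeff z D, b z) | z <- dom D]; split.
  by move=> _ /mapP[z _ ->]; exists z.
by rewrite big_map fgliftE.
Qed.

(** [h] pairs even permutations with odd ones, and the two terms cancel. This argument also covers
    characteristic two. *)
Lemma sum_perm_alternate m (h : 'S_m -> 'S_m) (f : 'S_m -> V) : injective h ->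
  (forall s, odd_perm (h s) = ~~ odd_perm s) -> (forall s, f (h s) = f s) ->
  \sum_(s : 'S_m) (-1) ^+ s *: f s = 0.
Proof.
move=> h_inj odd_h fh; rewrite (bigID (@odd_perm _)) /= (reindex_inj h_inj) /=.
under eq_bigl do rewrite odd_h.
rewrite -big_split /= big1 // => s es.
by rewrite odd_h fh (negPf es) expr1 expr0 scaleN1r scale1r addNr.
Qed.

End FreeModule.

Lemma initialE p (i : 'I_p) : initial i = fintype.lift ord_max i.
Proof. by rewrite lift_ord_max. Qed.

(** * Lattice points as exponents, with denominators cleared *)

Section Encoding.
Variables (k : fieldType) (n : nat).

Definition encode (K : nat) (z : 'rV[int]_n) : 'X_{1..n} :=
  [multinom absz (z ord0 c + K%:Z)%R | c < n].

(* [encode K z] stands for [z + (K, ..., K)], which is only correct when these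
   coordinates are nonnegative. *)
Definition encodable (K : nat) (z : 'rV[int]_n) : Prop := forall c, 0 <= z ord0 c + K%:Z.

Lemma encodeE K z c : encodable K z -> (encode K z c)%:Z = z ord0 c + K%:Z.
Proof. by move=> /(_ c) zK; rewrite mnmE gez0_abs. Qed.

Lemma encodableD K K' z z' :
  encodable K z -> encodable K' z' -> encodable (K + K') (z + z').
Proof.
by move=> zK zK' c; rewrite mxE PoszD addrACA addr_ge0.
Qed.

Lemma encodeD K K' z z' : encodable K z -> encodable K' z' ->
  encode (K + K') (z + z') = (encode K z + encode K' z')%MM.
Proof.
move=> zK zK'; apply/mnmP => c; apply/eqP; rewrite mnmDE -eqz_nat PoszD.
by rewrite !encodeE //; [rewrite mxE PoszD addrACA | exact: encodableD].
Qed.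

Lemma encode_inj K z z' : encodable K z -> encodable K z' ->
  encode K z = encode K z' -> z = z'.
Proof.
move=> zK zK' e; apply/rowP => c; apply: (addIr K%:Z).
by rewrite -!encodeE // e.
Qed.

Lemma encodable0 K : encodable K 0.
Proof. by move=> c; rewrite mxE add0r. Qed.

Lemma encodable_ex (s : seq 'rV[int]_n) :
  exists K, forall z, z \in s -> encodable K z.
Proof.
elim: s => [|z s [K KP]]; first by exists 0%N.
exists (\sum_c absz (z ord0 c) + K)%N => z'; rewrite inE => /predU1P[->|/KP z'K] c.
  rewrite (bigD1 c) //= -addnA PoszD addrA addr_ge0 // abszE.
  by rewrite addrC -[z ord0 c in X in _ + X]opprK subr_ge0 -normrN ler_norm.
by rewrite PoszD addrCA addr_ge0.
Qed.

End Encoding.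

Section Tensors.
Variables (k : fieldType) (p n : nat) (S T : set 'rV[int]_n) (Q : 'I_p.+1 -> T).
Hypothesis Q_bij : bijective Q.

Local Notation N := #|{: 'I_p * 'I_n}|.
Local Notation R := {mpoly k[N]}.

Definition encode_list (K : nat) (P : {ffun 'I_p -> S}) : 'X_{1..N} :=
  glue (fun i => encode K (val (P i))).

(** Slot [i] of a pure tensor gives the exponent of block [i]; the last factor selects the component
    [j]. *)
Definition encode_tens (K : nat) (j : 'I_p.+1) : tens k p S T -> R :=
  fglift (fun PQ => if PQ.2 == Q j then 'X_[encode_list K PQ.1] else 0).
HB.instance Definition _ K j := GRing.Linear.on (encode_tens K j).

Definition encodable_list K (P : {ffun 'I_p -> S}) := forall i, encodable K (val (P i)).

Lemma encode_list_inj K P P' : encodable_list K P -> encodable_list K P' ->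
  encode_list K P = encode_list K P' -> P = P'.
Proof.
move=> PK PK' e; apply/ffunP => i; apply: val_inj; apply: (encode_inj (PK i) (PK' i)).
by have := congr1 (block i) e; rewrite !block_glue.
Qed.

Lemma encode_tens_inj K v : (forall PQ, PQ \in dom v -> encodable_list K PQ.1) ->
  (forall j, encode_tens K j v = 0) -> v = 0.
Proof.
move=> vK v0; apply/eqP; rewrite -dom_eq0; case E: (dom v) => [//|[P q] d].
have Pd : (P, q) \in dom v by rewrite E mem_head.
have [Q' QK KQ] := Q_bij; have := congr1 (mcoeff (encode_list K P)) (v0 (Q' q)).
rewrite /encode_tens fgliftE raddf_sum mcoeff0 KQ /= (bigD1_seq (P, q)) ?uniq_dom //=.
rewrite mcoeffZ eqxx mcoeffX eqxx mulr1 big_seq_cond big1 ?addr0.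
  by move/eqP; rewrite mem_dom in Pd; rewrite (negPf Pd).
move=> [P' q'] /andP[Pd' ne]; rewrite mcoeffZ; case: eqP => /= [qq|_]; last first.
  by rewrite mcoeff0 mulr0.
rewrite mcoeffX; case: eqP => [e|_]; last by rewrite mulr0.
case/eqP: ne; congr (_, _) => //.
by apply: encode_list_inj e; [exact: (vK _ Pd') | exact: (vK _ Pd)].
Qed.

Definition point_exp K (b : 'I_p.+1) : 'X_{1..n} := encode K (val (Q b)).

Lemma encode_x_tens K K' (P : {ffun 'I_p -> translates S T}) j :
  (forall b, encodable K (val (Q b))) -> (forall i, encodable K' (val (P i))) ->
  encode_tens (K' + K) j (x_tens k Q P) =
  'X_[glue (fun i => encode K' (val (P i)))] * gen_minor k (point_exp K) j.
Proof.
move=> QK PK; rewrite gen_minorE mulr_sumr big_mkcond /x_tens raddf_sum /=.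
apply: eq_bigr => s _; rewrite linearZ /= /encode_tens fglift_pure /=.
rewrite (inj_eq (bij_inj Q_bij)); case: eqP => [_|_]; last by rewrite scaler0.
rewrite -scalerAr -mpolyXD -glueD; congr (_ *: 'X_[_]); apply: blockP => i.
by rewrite !block_glue ffunE /= encodeD; [| exact: PK | exact: QK].
Qed.

(** Up to sign, exchanging the values of [s] at slot [i] and at [ord_max] leaves the image under
    [delta_at i] unchanged, as only the sum of these two points of [T] enters; so the terms cancel
    in pairs. *)
Lemma delta_x_tens (P : {ffun 'I_p -> translates S T}) i : delta_at i (x_tens k Q P) = 0.
Proof.
rewrite /x_tens /delta_at raddf_sum /=.
under eq_bigr do rewrite linearZ /= fglift_pure.
have im : initial i != ord_max by rewrite initialE eq_sym neq_lift.
apply: (sum_perm_alternate (mulgI (tperm (initial i) ord_max))) => s.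
  by rewrite odd_mul_tperm im addTb.
congr pure.
  apply/ffunP => j; rewrite !ffunE permM; congr (tadd _ (Q (s _))).
  by rewrite tpermD // !initialE ?neq_lift // (inj_eq (@lift_inj _ _)) neq_lift.
apply: val_inj; rewrite /= !ffunE /= !permM tpermL tpermR.
by rewrite -!addrA; congr (_ + _); rewrite addrC.
Qed.

(** The last factor goes into the vacated block [i]. Being a sum of two points, it is shifted by
    [K + K]. *)
Definition encode_omit (K : nat) (i : 'I_p) (PR : {ffun 'I_p.-1 -> S} * sumset S T) : R :=
  'X_[glue (fun l => if unlift i l is Some l' then encode K (val (PR.1 l'))
                     else encode (K + K) (val PR.2))].

(** Multiplication by [gen_row] adds the point [Q b] to the exponent of block [i], as [delta_at i]
    adds it to the factor in slot [i]. *)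
Lemma encode_tens_ker K v i : (forall b, encodable K (val (Q b))) ->
  (forall PQ, PQ \in dom v -> encodable_list K PQ.1) -> delta_at i v = 0 ->
  \sum_b gen_row k (point_exp K) i b * encode_tens K b v = 0.
Proof.
move=> QK vK dv0.
have : fglift (encode_omit K i) (delta_at i v) = 0 by rewrite dv0 raddf0.
rewrite /delta_at [fglift _ v]fgliftE raddf_sum /= => E0; rewrite -[RHS]E0.
under eq_bigr do rewrite /encode_tens fgliftE mulr_sumr.
rewrite exchange_big /= big_seq [RHS]big_seq; apply: eq_bigr => -[P q] Pd /=.
have [Q' QKi KQ] := Q_bij; rewrite (bigD1 (Q' q)) //= KQ eqxx big1 ?addr0; last first.
  move=> b bq; case: eqP => [qb|]; last by rewrite scaler0 mulr0.
  by case/eqP: bq; rewrite qb QKi.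
rewrite linearZ /= fglift_pure -scalerAr /gen_row /encode_omit -mpolyXD.
congr (_ *: 'X_[_]); apply: blockP => l.
rewrite blockD block_glue1 !block_glue /point_exp KQ.
have qK : encodable K (val q) by rewrite -(KQ q).
case: unliftP => [l' ->|->].
  by rewrite eq_sym (negPf (neq_lift _ _)) add0m ffunE.
have PK : encodable K (val (P i)) := vK _ Pd i.
by rewrite eqxx addmC -(encodeD PK qK).
Qed.

End Tensors.

(** * The kernel of the generic matrix *)

Section Solutions.
Variables (k : fieldType) (p n : nat) (q : 'I_p.+1 -> 'X_{1..n}).
Hypothesis q_inj : injective q.
Variables (K : realType).

Local Notation N := #|{: 'I_p * 'I_n}|.
Local Notation R := {mpoly k[N]}.

Variable F : 'I_p.+1 -> R.

(** The Laurent polynomial that multiplies the minors is [c] divided by ['X_[m]], where ['X_[m]]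
    comes from the common factor [h]. *)
Lemma gen_row_ker (C : set 'rV[K]_n) : convex C ->
  (forall b, C (mvec K (q b))) -> (forall P, C (mvec K P) -> exists b, P = q b) ->
  ~ (exists o d : 'rV[int]_n, forall b, exists z : int, zvec (q b) = o + d *~ z) ->
  (forall i, \sum_b gen_row k q i b * F b = 0) ->
  exists (c : R) m, forall j, 'X_[m] * F j = c * gen_minor k q j.
Proof.
move=> cC qC Cq line FK.
have [c [h [g fg]]] := proportional_common_factor
  (@gcd_domain_mpoly k N (@gcd_domain_field k)) (gen_minor_neq0 k q_inj) (ker_minor FK).
have [m hm hE] := common_factor_monomial q_inj cC qC Cq line (fun j => (fg j).2).
exists ((h@_m)^-1 *: c), m => j; rewrite (fg j).1 [gen_minor _ _ _](fg j).2.
rewrite {2}hE; move: (h@_m) hm => a a0.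
by rewrite -!scalerAl -scalerAr scalerA mulVf // scale1r mulrCA.
Qed.

(** For [j] other than [b], the exponent [q b] occurs in block [i] of the minor [j], so
    [msuppM_convex] applies to the product of [c] and this minor. *)
Lemma gen_row_ker_support (C : set 'rV[K]_n) (c : R) m i : convex C ->
  (forall j, 'X_[m] * F j = c * gen_minor k q j) ->
  (forall j m', m' \in msupp ('X_[m] * F j) -> C (mvec K (block i m'))) ->
  forall P b, P \in msupp c -> C (mvec K (block i P + q b)%MM).
Proof.
move=> cC Fc FC P b Pc.
have [j bj] : exists j, b != j.
  have [->|ne] := eqVneq b ord_max; last by exists ord_max.
  by exists (fintype.lift ord_max i); rewrite neq_lift.
have qb : q b \in msupp (theta i (gen_minor k q j)).
  by rewrite mcoeff_msupp theta_minor_neq0.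
apply: (msuppM_convex cC _ (msupp_theta i Pc) qb) => m'.
by rewrite -rmorphM -Fc => /msupp_thetaP[m'' m''F <-]; exact: FC m''F.
Qed.

End Solutions.

(** * Translates, decoding of exponents and affine hulls *)

Section Geometry.
Variables (K : realType) (n : nat).

Lemma convex_translate (C : set 'rV[K]_n) w : convex C -> convex [set v | C (v - w)].
Proof.
move=> /convexP cC; apply/convexP => x y t t0 t1 Cx Cy /=.
suff -> : t *: x + (1 - t) *: y - w = t *: (x - w) + (1 - t) *: (y - w) by exact: cC.
by apply/rowP => c; rewrite !mxE; ring.
Qed.

Definition shift_vec (k : nat) : 'rV[K]_n := const_mx k%:R.

Lemma toRD x y : @toR K n (x + y) = toR K x + toR K y.
Proof. by apply/rowP => c; rewrite !mxE rmorphD. Qed.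

Lemma mvec_encode k z : encodable k z -> mvec K (encode k z) = toR K z + shift_vec k.
Proof.
move=> zk; apply/rowP => c; rewrite !mxE.
by rewrite -[_%:R]/((encode k z c)%:Z%:~R) encodeE // rmorphD.
Qed.

Lemma zvec_encode k (z : 'rV[int]_n) : encodable k z ->
  zvec (encode k z) = z + const_mx k%:Z.
Proof. by move=> zk; apply/rowP => c; rewrite !mxE encodeE // (ord1 ord0). Qed.

Lemma decode k (P : 'X_{1..n}) : let z := zvec P - const_mx k%:Z in
  encodable k z /\ encode k z = P.
Proof.
move=> z; have zc c : z ord0 c + k%:Z = (P c)%:Z by rewrite !mxE subrK.
split=> [c|]; first by rewrite zc.
by apply/mnmP => c; rewrite mnmE zc.
Qed.

Lemma affine_subspace_convex (a v : 'rV[K]_n) :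
  convex [set a + u | u in [set u | u \in <[v]>%VS]].
Proof.
apply/convexP => x y t _ _ [u uv <-] [w wv <-] /=.
exists (t *: u + (1 - t) *: w); first by rewrite /= rpredD ?rpredZ.
by apply/rowP => c; rewrite !mxE; ring.
Qed.

(** A line through the lattice points contains their convex hull [D], hence the affine hull of [D],
    whose dimension exceeds one. *)
Lemma not_collinear (D : set 'rV[K]_n) : lattice_polytope D ->
  (exists d, has_dim D d /\ (1 < d)%N) ->
  ~ exists o d : 'rV[int]_n, forall z, lattice_points D z ->
      exists a : int, z = o + d *~ a.
Proof.
move=> [s Ds] [d [[a [U [hullE dimU]]] d1]] [o [w line]].
pose L := [set toR K o + u | u in [set u | u \in <[toR K w]>%VS]].
have DL : D `<=` L.
  rewrite Ds; apply: smallest_sub; first exact: affine_subspace_convex.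
  move=> _ [P Ps <-].
  have [|b ->] := line P.
    by rewrite /lattice_points /= Ds; apply: sub_gen_smallest; exists P.
  exists (toR K w *~ b); first by rewrite /= rpredMz ?memv_line.
  by rewrite toRD /toR raddfMz.
have : affine_hull D `<=` L.
  apply: smallest_sub => //; exists (\dim <[toR K w]>%VS), (toR K o), <[toR K w]>%VS.
  by split.
rewrite hullE => UL.
have aL : L a by apply: UL; exists 0; rewrite ?addr0 //= mem0v.
have /dimvS : (U <= <[toR K w]>)%VS.
  apply/subvP => u uU; have [u1 u1w e1] := aL.
  have [|u2 u2w e2] := UL (a + u); first by exists u.
  have -> : u = u2 - u1.
    by apply: (addrI a); rewrite -e2 -e1 addrAC addrA subrK.
  exact: rpredB.
rewrite dimU dim_vline leqNgt; case/negP.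
by apply: leq_trans d1; rewrite ltnS; case: (_ != _).
Qed.

End Geometry.

(** * The common kernel of the maps [delta_at i] *)

Section KernelBasis.
Variables (k : fieldType) (p n : nat) (S T : set 'rV[int]_n) (Q : 'I_p.+1 -> T).
Hypothesis Q_bij : bijective Q.

Local Notation N := #|{: 'I_p * 'I_n}|.
Local Notation R := {mpoly k[N]}.

Lemma encodable_points : exists K, forall b, encodable K (val (Q b)).
Proof.
have [K KP] := encodable_ex [seq val (Q b) | b <- enum 'I_p.+1].
by exists K => b; apply: KP; apply/mapP; exists b => //; rewrite mem_enum.
Qed.

Lemma encodableW K K' (z : 'rV[int]_n) : encodable K' z -> encodable (K' + K) z.
Proof. by move=> zK; rewrite -[z]addr0; apply: encodableD => //; exact: encodable0. Qed.

Lemma point_exp_inj K : (forall b, encodable K (val (Q b))) ->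
  injective (point_exp Q K).
Proof.
move=> QK b b' e; apply: (bij_inj Q_bij); apply: val_inj.
exact: encode_inj (QK b) (QK b') e.
Qed.

Lemma encodable_family (A B : choiceType) (s : seq A) (f : A -> 'I_p -> 'rV[int]_n)
    (t : seq B) (g : B -> 'I_p -> 'rV[int]_n) :
  exists K, (forall a i, a \in s -> encodable K (f a i)) /\
            (forall b i, b \in t -> encodable K (g b i)).
Proof.
have [K KP] := encodable_ex ([seq f a i | a <- s, i <- enum 'I_p] ++
                             [seq g b i | b <- t, i <- enum 'I_p]).
exists K; split=> a i sa; apply: KP; rewrite mem_cat; apply/orP.
  by left; apply/allpairsP; exists (a, i); rewrite mem_enum.
by right; apply/allpairsP; exists (a, i); rewrite mem_enum.
Qed.

(** One component suffices: at [ord_max] the combination becomes a polynomial [w], with the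
    coefficients of [u], times a nonzero minor. *)
Lemma x_tens_inj (u : {freeg {ffun 'I_p -> translates S T} / k}) :
  fglift (x_tens k Q) u = 0 -> u = 0.
Proof.
move=> u0; have [K QK] := encodable_points.
have [K' [PK _]] := @encodable_family _ _ (dom u) (fun P i => val (P i)) (dom u)
  (fun P i => val (P i)).
pose e (P : {ffun 'I_p -> translates S T}) : 'X_{1..N} :=
  glue (fun i => encode K' (val (P i))).
pose w : R := \sum_(P <- dom u) coeff P u *: 'X_[e P].
have w0 : w = 0.
  apply/eqP; have := congr1 (encode_tens Q (K' + K) ord_max) u0.
  rewrite fgliftE raddf_sum raddf0 /=.
  have -> : \sum_(P <- dom u) encode_tens Q (K' + K) ord_max (coeff P u *: x_tens k Q P) =
      w * gen_minor k (point_exp Q K) ord_max.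
    rewrite /w mulr_suml big_seq [RHS]big_seq; apply: eq_bigr => P Pu.
    by rewrite linearZ /= encode_x_tens // ?scalerAl // => i; exact: PK.
  move/eqP; rewrite mulf_eq0 => /orP[//|].
  by rewrite (negPf (gen_minor_neq0 k (point_exp_inj QK))).
apply/eqP; rewrite -dom_eq0; case E: (dom u) => [//|P d].
have Pu : P \in dom u by rewrite E mem_head.
have := congr1 (mcoeff (e P)) w0.
rewrite mcoeff0 raddf_sum /= (bigD1_seq P) ?uniq_dom //= mcoeffZ mcoeffX eqxx mulr1.
rewrite big_seq_cond big1 ?addr0.
  by move/eqP; rewrite mem_dom in Pu; rewrite (negPf Pu).
move=> P' /andP[Pu' ne]; rewrite mcoeffZ mcoeffX; case: eqP => [ee|]; last by rewrite mulr0.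
case/eqP: ne; apply/ffunP => i; apply: val_inj.
apply: (encode_inj (PK _ i Pu') (PK _ i Pu)).
by have := congr1 (block i) ee; rewrite !block_glue.
Qed.

Lemma encode_tens_shift K K' j (v : tens k p S T) :
  (forall PQ, PQ \in dom v -> encodable_list K PQ.1) ->
  encode_tens Q (K' + K) j v =
  'X_[glue (fun=> encode K' 0)] * encode_tens Q K j v.
Proof.
move=> vK; rewrite /encode_tens !fgliftE mulr_sumr big_seq [RHS]big_seq.
apply: eq_bigr => -[P q] Pv /=; rewrite -scalerAr; case: eqP => _; last by rewrite mulr0.
rewrite -mpolyXD -glueD; congr (_ *: 'X_[_]); apply: blockP => i.
have PK : encodable K (val (P i)) := vK _ Pv i.
by rewrite !block_glue -(encodeD (encodable0 K') PK) add0r.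
Qed.

Section Span.
Variables (F : realType) (Delta Delta' : set 'rV[F]_n).
Hypothesis Delta_polytope : lattice_polytope Delta.
Hypothesis Delta_dim : exists d : nat, has_dim Delta d /\ (1 < d)%N.
Hypothesis Delta'_convex : convex Delta'.
Hypothesis S_def : S = lattice_points Delta'.
Hypothesis T_def : T = lattice_points Delta.

Lemma polytope_convex : convex Delta.
Proof.
have [s ->] := Delta_polytope; move=> x y t xA yA; apply/mem_set => A [cA sA].
apply: set_mem; apply: (cA); apply/mem_set.
  exact: (set_mem xA A (conj cA sA)).
exact: (set_mem yA A (conj cA sA)).
Qed.

Lemma x_tens_span (v : tens k p S T) : (forall i, delta_at i v = 0) ->
  exists u, v = fglift (x_tens k Q) u.
Proof.
move=> dv0; have [Q' QK' KQ'] := Q_bij.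
have TD t : T t -> Delta (toR F t) by rewrite T_def.
have SD s : S s -> Delta' (toR F s) by rewrite S_def.
have [K [QK vK]] : exists K, (forall b, encodable K (val (Q b))) /\
    (forall PQ, PQ \in dom v -> encodable_list K PQ.1).
  have [K1 QK] := encodable_points.
  have [K2 [vK _]] := @encodable_family _ _ (dom v) (fun PQ i => val (PQ.1 i)) (dom v)
    (fun PQ i => val (PQ.1 i)).
  exists (K1 + K2)%N; split=> [b|PQ PQv i]; first exact: encodableW.
  by rewrite addnC; apply: encodableW; exact: vK.
pose q := point_exp Q K; pose G j : R := encode_tens Q K j v.
have q_inj : injective q := point_exp_inj QK.
pose C := [set x | Delta (x - shift_vec F n K)].
have cC : convex C by exact: convex_translate polytope_convex.
have qC b : C (mvec F (q b)).
  rewrite /C /= mvec_encode // addrK.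
  exact: TD (set_valP (Q b)).
have Cq P : C (mvec F P) -> exists b, P = q b.
  have [zK zE] := decode K P; rewrite /C /= -{1}zE mvec_encode // addrK => DP.
  set z := (_ - _ : 'rV[int]_n) in zK zE DP.
  have zT : z \in T by apply/mem_set; rewrite T_def.
  by exists (Q' (exist _ z zT)); rewrite /q /point_exp KQ'.
have line : ~ exists o d : 'rV[int]_n, forall b, exists z : int, zvec (q b) = o + d *~ z.
  move=> [o [d od]]; apply: (not_collinear Delta_polytope Delta_dim).
  exists (o - const_mx K%:Z), d => z zD.
  have zT : z \in T by apply/mem_set; rewrite T_def.
  have [a] := od (Q' (exist _ z zT)).
  rewrite /q /point_exp KQ' zvec_encode /=; last by have := QK (Q' (exist _ z zT)); rewrite KQ'.
  by move=> e; exists a; rewrite addrAC -e addrK.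
have GK i : \sum_b gen_row k q i b * G b = 0 by apply: encode_tens_ker.
have [c [m Gc]] := gen_row_ker q_inj cC qC Cq line GK.
(* These are the exponents of [c] divided by ['X_[m]], where the shift by [K] has already
   cancelled. *)
pose z (P : 'X_{1..N}) i : 'rV[int]_n := zvec (block i P) - zvec (block i m).
have zX P i : P \in msupp c -> translates S T (z P i).
  move=> Pc _ [_ -> [t tT <-]]; pose b := Q' (exist _ t (mem_set tT)).
  (* [Delta'] is moved by [block i m] and by the shift [K], so as to contain the block [i] of all
     exponents of ['X_[m] * G j]. *)
  pose C' := [set x | Delta' (x - (mvec F (block i m) + shift_vec F n K))].
  have cC' : convex C' by exact: convex_translate.
  have := @gen_row_ker_support k p n q q_inj F G C' c m i cC' Gc _ P b Pc.
  rewrite /C' /= mvecD /q /point_exp {1}/b KQ' /= mvec_encode; last first.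
    by have := QK b; rewrite /b KQ'.
  rewrite S_def /lattice_points /= => H.
  suff -> : toR F (z P i + t) = mvec F (block i P) + (toR F t + shift_vec F n K) -
      (mvec F (block i m) + shift_vec F n K).
    apply: H => j m'; rewrite mcoeff_msupp /G /encode_tens fgliftE mulr_sumr raddf_sum /=.
    move=> m'0; have [[P' q'] Pv] : exists2 PQ, PQ \in dom v & exists2 m'',
        m'' = encode_list K PQ.1 & (m + m'')%MM = m'.
      apply/exists2P; apply: contrapT => nex; case/eqP: m'0.
      rewrite big_seq big1 // => PQ PQv; rewrite -scalerAr mcoeffZ.
      case: eqP => _; last by rewrite mulr0 mcoeff0 mulr0.
      rewrite -mpolyXD mcoeffX; case: eqP => [e|]; last by rewrite mulr0.
      by case: nex; exists PQ; split=> //; exists (encode_list K PQ.1).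
    move=> [m'' -> <-] /=; rewrite blockD block_glue mvecD mvec_encode; last exact: vK Pv i.
    rewrite opprD addrACA subrr add0r addrK.
    exact: SD (set_valP (P' i)).
  by apply/rowP => a; rewrite !mxE rmorphD rmorphB /=; ring.
(* By [zX] the second branch does not occur for [P] in the support of [c]; the case analysis
   supplies the membership proof inside the sum. *)
pose u : {freeg {ffun 'I_p -> translates S T} / k} := \sum_(P <- msupp c)
  match pselect (forall i, translates S T (z P i)) with
  | left H => [freeg [:: (c@_P, [ffun i => exist _ (z P i) (mem_set (H i))])]]
  | right _ => 0
  end.
exists u; apply/eqP; rewrite -subr_eq0; apply/eqP.
(* The points [z P i] may need a larger shift than [K], so the two sides are compared after encoding
   with [K' + K]. *)
have [K' [zK vuK]] := @encodable_family _ _ (msupp c) z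
  (dom (v - fglift (x_tens k Q) u)) (fun PQ i => val (PQ.1 i)).
apply: (@encode_tens_inj k p n S T Q Q_bij (K' + K)) => [PQ PQv i|j].
  by apply: encodableW; exact: vuK.
rewrite raddfB /= encode_tens_shift // -/(G j).
have Xm0 : 'X_[m] != 0 :> R by rewrite -msupp_eq0 msuppX.
apply: (mulfI Xm0); rewrite mulr0 mulrBr mulrCA Gc; apply/eqP; rewrite subr_eq0.
rewrite {1}(mpolyE c) /u raddf_sum /= mulr_suml mulr_sumr raddf_sum mulr_sumr.
apply/eqP; rewrite big_seq [RHS]big_seq; apply: eq_bigr => P Pc.
case: pselect => [H|]; last by case=> i; exact: zX.
rewrite /= [fglift (x_tens k Q) _]liftU linearZ /= encode_x_tens //;
  last by move=> i; rewrite ffunE; exact: zK.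
rewrite -!scalerAl -!scalerAr !mulrA -!mpolyXD; congr (_ *: ('X_[_] * _)).
apply: blockP => i; rewrite !blockD !block_glue ffunE /=.
apply/mnmP => a; apply/eqP; rewrite !mnmDE -eqz_nat !PoszD.
rewrite (encodeE a (zK P i Pc)) (encodeE a (@encodable0 n K')).
by rewrite !mxE; apply/eqP; ring.
Qed.

End Span.
End KernelBasis.

(** * Alternating tensors *)

Section Alternation.
Variable k : fieldType.

Lemma lift_perm_surj m (s : 'S_m.+1) i : exists t, s = lift_perm i (s i) t.
Proof.
have [t [st _]] := omit_perm k s i; exists t; apply/permP => j.
by case: (unliftP i j) => [j'|] ->; rewrite ?lift_perm_id // lift_perm_lift st.
Qed.

Lemma lift_perm_inj m (i j : 'I_m.+1) : injective (lift_perm i j).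
Proof.
move=> s t st; apply/permP => a; apply: (@lift_inj _ j).
by rewrite -!(lift_perm_lift i) st.
Qed.

Lemma big_lift_perm (V : nmodType) m (i : 'I_m.+1) (F : 'S_m.+1 -> V) :
  \sum_s F s = \sum_j \sum_(t : 'S_m) F (lift_perm i j t).
Proof.
rewrite (partition_big (fun s : 'S_m.+1 => s i) xpredT) //=; apply: eq_bigr => j _.
rewrite (reindex (lift_perm i j)) /=.
  by apply: eq_bigl => t; rewrite lift_perm_id eqxx.
have /choice[g gE] s := lift_perm_surj s i.
exists g => [t _|s]; last by rewrite inE => /eqP <-; rewrite -gE.
by apply: (@lift_perm_inj _ i j); rewrite [RHS]gE lift_perm_id.
Qed.

Section Alt.
Variables (n p : nat) (S T : set 'rV[int]_n).

Definition permute (X : Type) (P : {ffun 'I_p -> X}) (t : 'S_p) : {ffun 'I_p -> X} :=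
  [ffun i => P (t i)].

Lemma permuteM (X : Type) (P : {ffun 'I_p -> X}) s t :
  permute (permute P s) t = permute P (t * s)%g.
Proof. by apply/ffunP => i; rewrite !ffunE permM. Qed.

Lemma permute1 (X : Type) (P : {ffun 'I_p -> X}) : permute P 1%g = P.
Proof. by apply/ffunP => i; rewrite ffunE perm1. Qed.

(** The antisymmetrization is not divided by the number of permutations, so that it makes sense in
    every characteristic. *)
Definition alt : tens k p S T -> tens k p S T :=
  fglift (fun PQ => \sum_(t : 'S_p) (-1) ^+ t *: pure k (permute PQ.1 t) PQ.2).
HB.instance Definition _ := GRing.Linear.on alt.

Lemma alt_pure P Q : alt (pure k P Q) = \sum_(t : 'S_p) (-1) ^+ t *: pure k (permute P t) Q.
Proof. by rewrite /alt fglift_pure. Qed.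

Lemma alt_permute P Q s :
  alt (pure k (permute P s) Q) = (-1) ^+ s *: alt (pure k P Q).
Proof.
rewrite !alt_pure scaler_sumr [RHS](reindex_inj (mulIg s)) /=; apply: eq_bigr => t _.
rewrite permuteM scalerA odd_permM -signr_addb addbC addbK //.
Qed.

Lemma noninjective_eq (X : eqType) (P : {ffun 'I_p -> X}) :
  ~ injective P -> exists a b, a != b /\ P a = P b.
Proof.
move=> nP; apply: contrapT => nab; apply: nP => a b Pab; apply/eqP/negPn/negP => ab.
by apply: nab; exists a, b.
Qed.

Lemma alt_noninjective (P : {ffun 'I_p -> S}) Q : ~ injective P -> alt (pure k P Q) = 0.
Proof.
move=> /noninjective_eq[a [b [ab Pab]]]; rewrite alt_pure.
apply: (sum_perm_alternate (mulIg (tperm a b))) => t.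
  by rewrite odd_permM odd_tperm ab addbT.
congr pure; apply/ffunP => i; rewrite !ffunE permM.
by case: tpermP => [->|->|].
Qed.

Lemma alt_span v : v \in spanp (@alt_rel k n p S T) -> alt v = 0.
Proof.
move=> /spanpP[s [sR ->]]; rewrite raddf_sum big_seq big1 //= => x xs.
rewrite linearZ /=; suff -> : alt x.2 = 0 by rewrite scaler0.
case: (sR _ xs) => [[P [Q [nP ->]]]|[P [Q [t ->]]]]; first exact: alt_noninjective.
by rewrite linearB linearZ /= -/(permute P t) alt_permute subrr.
Qed.

(* Alternation is injective on the exterior power: a term which is cancelled in
   [alt v] is a permutation of another term of [v], and can be moved to it. *)
Lemma alt_ker v : alt v = 0 -> v \in spanp (@alt_rel k n p S T).
Proof.
have [N] := ubnP (size (dom v)); elim: N v => // N IH v; rewrite ltnS => szv v0.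
have [->|vn0] := eqVneq v 0; first exact: spanp0.
have [[P Q] Pv] : exists z, z \in dom v.
  by case E: (dom v) => [|z d];
    [move/eqP: E; rewrite dom_eq0 (negPf vn0) | exists z; rewrite mem_head].
have rem w : (forall z, z \in dom w -> z \in dom v) -> coeff (P, Q) w = 0 ->
    (size (dom w) < N)%N.
  move=> wv w0; apply: leq_trans szv.
  suff : (size ((P, Q) :: dom w) <= size (dom v))%N by [].
  apply: uniq_leq_size => [|z]; first by rewrite /= uniq_dom mem_dom w0 eqxx.
  by rewrite inE => /predU1P[->|/wv].
pose c := coeff (P, Q) v.
have coeff_pure z P' Q' : coeff z (pure k P' Q' : tens k p S T) = ((P', Q') == z)%:R.
  by rewrite /pure coeffU mul1r.
have [Pinj|nP] := pselect (injective P); last first.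
  have nPv : alt_rel (pure k P Q) by left; exists P, Q.
  rewrite -[v](subrK (c *: pure k P Q)); apply: spanpD; last first.
    by apply: spanpZ; exact: spanp_gen.
  apply: IH; last by rewrite linearB linearZ /= v0 alt_noninjective // scaler0 subr0.
  apply: rem => [z|]; last by rewrite coeffB coeffZ coeff_pure eqxx mulr1 subrr.
  rewrite mem_dom coeffB coeffZ coeff_pure.
  have [<- //|_] := eqVneq (P, Q) z; by rewrite mulr0 subr0 mem_dom.
have [[P1 Q1] P1v [ne [t [P1E QE]]]] : exists2 z, z \in dom v &
    z != (P, Q) /\ exists t : 'S_p, permute z.1 t = P /\ z.2 = Q.
  apply: contrapT => nex; have := congr1 (coeff (P, Q)) v0.
  rewrite /alt fgliftE raddf_sum coeff0 /= (bigD1_seq (P, Q)) ?uniq_dom //=.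
  rewrite [X in _ + X]big_seq_cond [X in _ + X]big1 ?addr0.
    rewrite coeffZ raddf_sum (bigD1 1%g) //= [X in _ + X]big1 ?addr0.
      rewrite coeffZ coeff_pure permute1 eqxx odd_perm1 expr0 !mulr1.
      by move/eqP; apply/negP; rewrite -mem_dom.
    move=> t t1; rewrite coeffZ coeff_pure; case: eqP => [[e]|]; last by rewrite mulr0.
    case/eqP: t1; apply/permP => i; apply: Pinj.
    by have := congr1 (fun f : {ffun _} => f i) e; rewrite ffunE perm1.
  move=> z /andP[zv zne]; rewrite coeffZ raddf_sum big1 ?mulr0 //= => t _.
  rewrite coeffZ coeff_pure; case: eqP => [[e1 e2]|]; last by rewrite mulr0.
  by case: nex; exists z => //; split=> //; exists t.
rewrite /= in P1E QE; rewrite QE in ne P1v.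
have rel : alt_rel (pure k P Q - (-1) ^+ t *: pure k P1 Q).
  by right; exists P1, Q, t; rewrite -P1E.
rewrite -[v](subrK (c *: (pure k P Q - (-1) ^+ t *: pure k P1 Q))); apply: spanpD; last first.
  by apply: spanpZ; exact: spanp_gen.
apply: IH.
  apply: rem => [z|].
    rewrite !mem_dom coeffB coeffZ coeffB coeffZ !coeff_pure.
    have [<- _|_] := eqVneq (P, Q) z; first by rewrite -mem_dom.
    have [<- _|_] := eqVneq (P1, Q) z; first by rewrite -mem_dom.
    by rewrite mulr0 subr0 mulr0 subr0.
  rewrite coeffB coeffZ coeffB coeffZ !coeff_pure eqxx (negPf ne).
  by rewrite mulr0 subr0 mulr1 subrr.
by rewrite linearB linearZ /= v0 (alt_span (spanp_gen rel)) scaler0 subr0.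
Qed.

Lemma alt_permuted v t : fglift (fun PQ => pure k (permute PQ.1 t) PQ.2) (alt v) =
  (-1) ^+ t *: alt v.
Proof.
rewrite /alt [fglift _ v]fgliftE raddf_sum scaler_sumr; apply: eq_bigr => -[P Q] _ /=.
rewrite linearZ scalerA mulrC -scalerA /=; congr (_ *: _).
rewrite raddf_sum scaler_sumr [RHS](reindex_inj (mulgI t)) /=; apply: eq_bigr => s _.
by rewrite linearZ /= fglift_pure /= permuteM scalerA odd_permM
  signr_addb mulrA -signr_addb addbb mul1r.
Qed.

End Alt.

(** The permutations are grouped by the factor [j] that they bring to slot [i]. The sign of
    [lift_perm i j t] is that of [t] times [(-1) ^ (i + j)], which yields the alternating sum of
    [delta_tens]. *)
Lemma delta_at_alt n p (S T : set 'rV[int]_n) (i : 'I_p) (v : tens k p S T) :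
  delta_at i (alt v) = (-1) ^+ i.+1 *: alt (delta_tens v).
Proof.
case: p i v => [[]//|p] i v.
rewrite {1}/alt /delta_tens [X in alt X]fgliftE [fglift _ v]fgliftE.
rewrite /delta_at raddf_sum [alt _]raddf_sum /= scaler_sumr.
apply: eq_bigr => -[P Q] _ /=.
rewrite linearZ [alt _]linearZ /= [RHS]scalerA [_ * coeff _ _]mulrC -[RHS]scalerA.
congr (_ *: _).
rewrite raddf_sum [alt _]raddf_sum /= (big_lift_perm i) scaler_sumr; apply: eq_bigr => j _ /=.
rewrite linearZ /= alt_pure [RHS]scalerA scaler_sumr; apply: eq_bigr => t _.
rewrite linearZ /= fglift_pure /= [RHS]scalerA; congr (_ *: pure _ _ _).
- rewrite odd_lift_perm -(signr_odd _ i.+1) -(signr_odd _ j.+1) -!signr_addb /=.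
  by congr (_ ^+ nat_of_bool _); case: odd; case: odd.
- by apply/ffunP => a; rewrite !ffunE lift_perm_lift.
- by rewrite !ffunE lift_perm_id.
Qed.

End Alternation.

(** * Cosets of the stabilizer of a list *)

Section Cosets.
Variables (k : fieldType) (n p : nat) (S T : set 'rV[int]_n) (Q : 'I_p.+1 -> T).
Implicit Types (P : {ffun 'I_p -> translates S T}) (r t : 'S_p) (s : 'S_p.+1).

Definition embed r : 'S_p.+1 := lift_perm ord_max ord_max r.

Lemma embed_initial r s i : (embed r * s)%g (initial i) = s (initial (r i)).
Proof. by rewrite permM !initialE lift_perm_lift. Qed.

Lemma embed_max r s : (embed r * s)%g ord_max = s ord_max.
Proof. by rewrite permM lift_perm_id. Qed.

Lemma odd_embed r s : odd_perm (embed r * s)%g = odd_perm r (+) odd_perm s.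
Proof. by rewrite odd_permM odd_lift_perm addbb. Qed.

Lemma shifted_embed P r s :
  shifted Q (permute P r) (embed r * s) = permute (shifted Q P s) r.
Proof. by apply/ffunP => i; rewrite !ffunE embed_initial. Qed.

Definition x_term P s t : tens k p S T :=
  ((-1) ^+ s * (-1) ^+ t) *: pure k (permute (shifted Q P s) t) (Q (s ord_max)).

Lemma x_term_embed P r s t : permute P r = P ->
  x_term P (embed r * s) t = x_term P s (t * r)%g.
Proof.
move=> Pr; rewrite /x_term embed_max -{1}Pr shifted_embed permuteM; congr (_ *: _).
by rewrite -!signr_addb odd_embed odd_permM; case: odd_perm; case: odd_perm; case: odd_perm.
Qed.

Lemma x_tens_permute P t : x_tens k Q (permute P t) = \sum_s x_term P s t.
Proof.
rewrite /x_tens (reindex_inj (mulgI (embed t))) /=; apply: eq_bigr => s _.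
by rewrite /x_term shifted_embed embed_max odd_embed signr_addb mulrC.
Qed.

(** The classes of [same_blocks] are the cosets of the stabilizer of [P], seen among the
    permutations fixing [ord_max]. *)
Lemma same_blocksP P s s' :
  reflect (exists2 r, permute P r = P & s' = (embed r * s)%g) (same_blocks P s s').
Proof.
apply: (iffP forallP) => [blocks|[r Pr ->] i0]; last first.
  have Pi i : P (r i) = P i by rewrite -[in RHS]Pr ffunE.
  apply/eqP/setP => a; apply/imsetP/imsetP => -[i iP ->]; rewrite inE in iP.
    exists ((r^-1)%g i); last by rewrite embed_initial permKV.
    by rewrite inE -Pi permKV.
  by exists (r i); [rewrite inE Pi | rewrite embed_initial].
have init i : exists2 j, P j = P i & s' (initial i) = s (initial j).
  have /eqP/setP/(_ (s' (initial i))) := blocks i.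
  rewrite [X in _ = X](_ : _ = true); last by apply/imsetP; exists i => //; rewrite inE eqxx.
  by case/imsetP => j; rewrite inE => /eqP Pj e; exists j.
pose u := (s' * s^-1)%g.
have u_init i j : s' (initial i) = s (initial j) -> u (initial i) = initial j.
  by move=> e; rewrite permM e permK.
(* [u] sends initial slots to initial slots, so only [ord_max] can be sent to [ord_max]. *)
have umax : u ord_max = ord_max.
  have [b ub] : exists b, u b = ord_max by exists ((u^-1)%g ord_max); exact: permKV.
  move: (ub); case: (unliftP ord_max b) => [i ->|-> //].
  rewrite -initialE; have [j _ /u_init ->] := init i.
  by rewrite initialE => /eqP; rewrite eq_sym (negPf (neq_lift _ _)).
have [r ur] := lift_perm_surj k u ord_max; rewrite umax in ur.
have s'E : s' = (embed r * s)%g by rewrite /embed -ur mulgKV.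
exists r => //; apply/ffunP => i; rewrite ffunE.
have [j <- e] := init i; congr (P _); move: e; rewrite s'E embed_initial.
by move/perm_inj; rewrite !initialE => /lift_inj.
Qed.

Lemma same_blocks_equiv P : {in [set: 'S_p.+1]%SET & &, equivalence_rel (same_blocks P)}.
Proof.
move=> s1 s2 s3 _ _ _; split; first by apply/forallP => i.
move=> /forallP s12; apply/forallP/forallP => s3E i; apply/eqP.
  by rewrite -(eqP (s12 i)) (eqP (s3E i)).
by rewrite (eqP (s12 i)) (eqP (s3E i)).
Qed.

(** Every permutation is [embed r * x] for exactly one [x] in the transversal and one [r]
    stabilizing [P]. *)
Lemma big_transversal (V : nmodType) P (F : 'S_p.+1 -> V) :
  \sum_(x in transversal (equivalence_partition (same_blocks P) [set: 'S_p.+1]%SET)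
      [set: 'S_p.+1]%SET) \sum_(r | permute P r == P) F (embed r * x)%g = \sum_s F s.
Proof.
set E := equivalence_partition _ _; set X := transversal _ _.
have partE := equivalence_partitionP (@same_blocks_equiv P).
have /and3P[_ _ /forall_inP X1] := transversalP partE.
have uniqX s : exists x0, forall x, (x \in X) && same_blocks P x s = (x == x0).
  have sE : s \in finset.cover E by have /and3P[/eqP -> _ _] := partE; rewrite inE.
  have /cards1P[x0 /setP x0E] := X1 _ (pblock_mem sE).
  exists x0 => x; have := x0E x; rewrite !inE => <-; congr (_ && _).
  rewrite (pblock_equivalence_partition (@same_blocks_equiv P)) ?inE //.
  by apply/forallP/forallP => e i; rewrite eq_sym; exact: e.
transitivity (\sum_s \sum_(x in X | same_blocks P x s) F s).
  rewrite (exchange_big_dep (mem X)) /=; last by move=> s x _ /andP[].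
  apply: eq_bigr => x xX.
  have /choice[g gE] s : exists r, same_blocks P x s ->
      permute P r = P /\ s = (embed r * x)%g.
    have [/same_blocksP[r Pr sE]|_] := boolP (same_blocks P x s); last by exists 1%g.
    by exists r.
  rewrite [RHS](reindex (fun r => embed r * x)%g) /=.
    apply: eq_bigl => r; rewrite xX /=; apply/eqP/same_blocksP => [Pr|[r' Pr' /mulIg]].
      by exists r.
    by move/lift_perm_inj => ->.
  exists g => [r|s]; rewrite inE xX /= => /gE[_ e] //.
  by move/mulIg: e => /lift_perm_inj.
apply: eq_bigr => s _; have [x0 x0E] := uniqX s.
by rewrite (eq_bigl _ _ x0E) big_pred1_eq.
Qed.
End Cosets.

Lemma fglift_comp (k : fieldType) (I : choiceType) (V W : lmodType k)
    (phi : {linear V -> W}) (f : I -> V) (u : {freeg I / k}) :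
  phi (fglift f u) = fglift (fun i => phi (f i)) u.
Proof.
by rewrite !fgliftE linear_sum; apply: eq_bigr => i _; rewrite linearZ.
Qed.

Lemma sum_coeff_dom (k : fieldType) (I : choiceType) (u : {freeg I / k}) i :
  \sum_(z <- dom u) coeff z u * (z == i)%:R = coeff i u.
Proof.
rewrite -[in RHS](freeg_sumE u) raddf_sum; apply: eq_bigr => z _.
by rewrite /= coeffU.
Qed.

(** * Monomials and their lists of points *)

Section Monomials.
Variables (X : choiceType) (p : nat).
Implicit Types (P : {ffun 'I_p -> X}) (A : monalg.cmonom X).

Definition monomial_of P : monalg.cmonom X :=
  \big[@monalg.mulcm X / monalg.onecm X]_(i < p) monalg.ucm (P i).

Lemma lists_monomial_of P : lists (monomial_of P) P.
Proof.
move=> x; rewrite /monomial_of.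
rewrite (big_morph (fun m : monalg.cmonom X => monalg.cmonom_val m x)
  (fun m1 m2 => monalg.mulcmE m1 m2 x)
  (monalg.onecmE x)).
rewrite -sum1_card big_mkcond /=; apply: eq_bigr => i _.
by rewrite monalg.ucmE inE; case: eqP.
Qed.

Lemma mdeg_monomial_of P : monalg.mdeg (monomial_of P) == p.
Proof.
rewrite /monomial_of (big_morph _ (@monalg.mdegM X) (@monalg.mdeg1 X)).
under eq_bigr do rewrite monalg.mdegU.
by rewrite sum1_card card_ord.
Qed.

Lemma lists_inj A A' P : lists A P -> lists A' P -> A = A'.
Proof.
move=> AP A'P; apply: (elimT eqP (introT (monalg.cmP A A') _)) => x.
by rewrite -AP -A'P.
Qed.

Lemma lists_permute A P t : lists A P -> lists A (permute P t).
Proof.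
move=> AP x; rewrite -AP -!sum1_card [RHS](reindex_inj (@perm_inj _ t)) /=.
by apply: eq_bigl => i; rewrite !inE ffunE.
Qed.

Lemma lists_permuted A P P' : lists A P -> lists A P' -> exists t, P' = permute P t.
Proof.
move=> AP AP'.
have cnt (f : {ffun 'I_p -> X}) x : count_mem x [tuple f i | i < p] = #|[pred i | f i == x]|.
  by rewrite -sum1_count big_map big_enum_cond -sum1_card.
have /tuple_permP[t tE] : perm_eq [tuple P' i | i < p] [tuple P i | i < p].
  by apply/allP => x _; rewrite /= !cnt AP AP'.
exists t; apply/ffunP => i; rewrite ffunE.
have := congr1 (fun s => nth (P' i) s i) tE.
by rewrite -!tnth_nth !tnth_mktuple.
Qed.

(** Repetitions are removed: if [P] has equal entries, each distinct rearrangement still counts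
    once. *)
Definition perms P : seq {ffun 'I_p -> X} :=
  undup [seq permute P t | t <- enum {: 'S_p}].

Lemma permsP P P' : reflect (exists t, P' = permute P t) (P' \in perms P).
Proof.
rewrite mem_undup; apply: (iffP mapP) => [[t _ ->]|[t ->]]; exists t => //.
by rewrite mem_enum.
Qed.

Lemma big_perms (V : nmodType) P (F : 'S_p -> V) :
  \sum_t F t = \sum_(P' <- perms P) \sum_(t | permute P t == P') F t.
Proof.
rewrite (exchange_big_dep xpredT) //=; apply: eq_bigr => t _.
rewrite -big_filter (perm_big [:: permute P t]) ?big_seq1 //.
apply: uniq_perm => [||P']; rewrite ?filter_uniq ?undup_uniq //.
rewrite mem_filter inE eq_sym; case: eqP => //= ->.
by apply/permsP; exists t.
Qed.

End Monomials.

Lemma perms_lists (X : choiceType) p (A : monalg.cmonom X) (L P : {ffun 'I_p -> X}) :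
  lists A L -> reflect (lists A P) (P \in perms L).
Proof.
move=> AL; apply: (iffP (permsP _ _)) => [[t ->]|AP]; first exact: lists_permute.
exact: lists_permuted AP.
Qed.

(** * The elements [x_wedge] under alternation *)

Section Part2.
Variables (k : fieldType) (n p : nat) (S T : set 'rV[int]_n) (Q : 'I_p.+1 -> T).
Local Notation X := (translates S T).
Implicit Types (P : {ffun 'I_p -> X}).

Definition x_lift P : tens k p S T :=
  \sum_(s in transversal (equivalence_partition (same_blocks P) [set: 'S_p.+1]%SET)
                         [set: 'S_p.+1]%SET)
    (-1) ^+ s *: pure k (shifted Q P s) (Q (s ord_max)).

Lemma qproj_x_lift P : qproj (@alt_rel k n p S T) (x_lift P) = x_wedge k Q P.
Proof.
by rewrite /x_lift linear_sum; apply: eq_bigr => s _; rewrite linearZ.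
Qed.

(** The permutations [t] with a given rearrangement [permute P t0] form the coset of the products
    [t0 * r] with [r] stabilizing [P]. By [x_term_embed], [r] can be moved to [s], where together
    with the transversal it yields all permutations and so the whole of [x_tens]. *)
Lemma alt_x_lift P : alt (x_lift P) = \sum_(P' <- perms P) x_tens k Q P'.
Proof.
transitivity (\sum_(s in transversal (equivalence_partition (same_blocks P) [set: 'S_p.+1]%SET)
                         [set: 'S_p.+1]%SET) \sum_t x_term k Q P s t).
  rewrite /x_lift linear_sum; apply: eq_bigr => s _.
  rewrite linearZ /= alt_pure scaler_sumr; apply: eq_bigr => t _.
  by rewrite scalerA.
under eq_bigr do rewrite (big_perms P).
rewrite exchange_big /= big_seq [RHS]big_seq; apply: eq_bigr => P' /permsP[t0 ->].
rewrite x_tens_permute -(big_transversal k P); apply: eq_bigr => s _.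
have permE r : (permute P (t0 * r)%g == permute P t0) = (permute P r == P).
  rewrite -permuteM; apply/eqP/eqP => [e|-> //].
  by rewrite -[LHS]permute1 -[in RHS](permute1 P) -(mulVg t0) -!permuteM e.
rewrite (reindex_inj (mulgI t0)) /=; apply: eq_big => [//|r].
by rewrite permE => /eqP Pr; rewrite x_term_embed.
Qed.

Section Representatives.
Variables (I : choiceType) (L : I -> {ffun 'I_p -> X}).
Hypothesis L_uniq : forall A A' P, P \in perms (L A) -> P \in perms (L A') -> A = A'.

Definition symmetrize : {freeg I / k} -> {freeg {ffun 'I_p -> X} / k} :=
  fglift (fun A => \sum_(P <- perms (L A)) [freeg [:: (1, P)]]).

Lemma coeff_perms A P :
  coeff P (\sum_(P' <- perms (L A)) [freeg [:: (1 : k, P')]]) = (P \in perms (L A))%:R.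
Proof.
rewrite raddf_sum /=; under eq_bigr do rewrite coeffU mul1r.
have [PA|PA] := boolP (P \in _).
  rewrite (bigD1_seq P) ?undup_uniq //= eqxx big1 ?addr0 // => P' /negPf ne.
  by rewrite ne.
rewrite big_seq big1 // => P' P'A; case: eqP => // e.
by rewrite -e P'A in PA.
Qed.

Lemma coeff_symmetrize A P u : P \in perms (L A) -> coeff P (symmetrize u) = coeff A u.
Proof.
move=> PA; rewrite /symmetrize fgliftE raddf_sum -[RHS]sum_coeff_dom.
apply: eq_bigr => A' _; rewrite /= coeffZ coeff_perms; congr (_ * _%:R).
by apply: congr1; apply/idP/eqP => [PA'|-> //]; exact: L_uniq PA' PA.
Qed.

Lemma alt_x_lifts u : alt (fglift (fun A => x_lift (L A)) u) =
  fglift (x_tens k Q) (symmetrize u).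
Proof.
transitivity (fglift (fun A => alt (x_lift (L A))) u).
  exact: (fglift_comp (@alt k n p S T)).
have -> := fglift_comp (fglift (x_tens k Q)) _ u.
congr (fglift _ u); apply: funext => A /=; rewrite alt_x_lift raddf_sum.
by apply: eq_bigr => P _; rewrite /= liftU scale1r.
Qed.

Lemma qproj_x_lifts u : qproj (@alt_rel k n p S T) (fglift (fun A => x_lift (L A)) u) =
  fglift (fun A => x_wedge k Q (L A)) u.
Proof.
rewrite fglift_comp; congr (fglift _ u); apply: funext => A.
exact: qproj_x_lift.
Qed.

End Representatives.

(** By [delta_at_alt] a single slot gives the converse. For [p = 0] there is no slot, but then
    [delta_tens] is an empty sum. *)
Lemma alt_delta_tens (v : tens k p S T) :
  (forall i, delta_at i (alt v) = 0) <-> alt (delta_tens v) = 0.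
Proof.
split=> [dv0|a0 i]; last by rewrite delta_at_alt a0 scaler0.
case: (posnP p) => [p0|p_gt0].
  suff -> : delta_tens v = 0 by rewrite raddf0.
  rewrite /delta_tens fgliftE big1 // => PQ _; rewrite big1 ?scaler0 // => i _.
  have p_gt0 : (0 < p)%N := leq_ltn_trans (leq0n i) (ltn_ord i).
  by exfalso; move: p_gt0; rewrite p0.
have := dv0 (Ordinal p_gt0); rewrite delta_at_alt.
move=> /(congr1 (fun w => (-1) ^+ (Ordinal p_gt0).+1 *: w)).
by rewrite scalerA -expr2 sqrr_sign scale1r scaler0.
Qed.

Hypothesis Q_bij : bijective Q.

(** Permuting the slots by [t] multiplies [alt v] by the sign of [t], and takes [x_tens] of a list
    to that sign times [x_tens] of the permuted list. Independence of these elements lets the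
    coefficients be compared. *)
Lemma coeff_alt_invariant (v : tens k p S T) c P t :
  alt v = fglift (x_tens k Q) c -> coeff (permute P t) c = coeff P c.
Proof.
move=> vc; pose c' : {freeg {ffun 'I_p -> X} / k} :=
  fglift (fun P' => [freeg [:: (1, permute P' t)]]) c.
have permute_inj : injective (fun P' : {ffun 'I_p -> X} => permute P' t).
  move=> P1 P2 e; rewrite -[P1]permute1 -[P2]permute1 -(mulVg t) -!permuteM.
  by rewrite e.
suff c'E : c' = c.
  rewrite -[in LHS]c'E /c' fgliftE raddf_sum /= -[in RHS](freeg_sumE c) raddf_sum.
  apply: eq_bigr => P' _ /=; rewrite coeffZ !coeffU mul1r.
  by rewrite (inj_eq permute_inj).
apply/eqP; rewrite -subr_eq0; apply/eqP; apply: (x_tens_inj Q_bij).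
rewrite raddfB /= -vc; apply/eqP; rewrite subr_eq0; apply/eqP.
have act P' : fglift (fun PQ => pure k (permute PQ.1 t) PQ.2) (x_tens k Q P') =
    (-1) ^+ t *: x_tens k Q (permute P' t).
  rewrite x_tens_permute /x_tens linear_sum [RHS]scaler_sumr. apply: eq_bigr => s _.
  rewrite linearZ /= fglift_pure /= /x_term scalerA; congr (_ *: _).
  by rewrite -!signr_addb addbCA addbb addbF.
have := alt_permuted v t; rewrite {1}vc fglift_comp => /(congr1 (fun w => (-1) ^+ t *: w)).
rewrite scalerA -signr_addb addbb scale1r => <-.
rewrite /c' fglift_comp !fgliftE scaler_sumr; apply: eq_bigr => P' _ /=.
rewrite act liftU scale1r scalerA mulrC -scalerA; congr (_ *: _).
by rewrite scalerA -signr_addb addbb scale1r.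
Qed.

End Part2.

Lemma delta_x_tens_span (k : fieldType) n p (S T : set 'rV[int]_n) (Q : 'I_p.+1 -> T)
    (u : {freeg {ffun 'I_p -> translates S T} / k}) i :
  delta_at i (fglift (x_tens k Q) u) = 0.
Proof.
rewrite /delta_at fglift_comp fgliftE big1 // => P _.
by have := delta_x_tens k Q P i; rewrite /delta_at /= => ->; rewrite scaler0.
Qed.

(** * The kernel of [delta] on the exterior power *)

Section ExteriorBasis.
Variables (k : fieldType) (n p : nat) (S T : set 'rV[int]_n) (Q : 'I_p.+1 -> T).
Local Notation X := (translates S T).
Hypothesis Q_bij : bijective Q.
Hypothesis span_ker : forall v : tens k p S T, (forall i, delta_at i v = 0) ->
  exists u, v = fglift (x_tens k Q) u.
Variables (I : choiceType) (L : I -> {ffun 'I_p -> X}).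
Hypothesis L_uniq : forall A A' P, P \in perms (L A) -> P \in perms (L A') -> A = A'.
Hypothesis L_all : forall P, exists A, P \in perms (L A).

Lemma x_wedge_inj u : fglift (fun A => x_wedge k Q (L A)) u = 0 -> u = 0.
Proof.
rewrite -qproj_x_lifts => /qproj_eq0/alt_span; rewrite alt_x_lifts => /(x_tens_inj Q_bij) u0.
apply/eqP/freeg_eqP => A; rewrite coeff0.
have LA : L A \in perms (L A) by apply/permsP; exists 1%g; rewrite permute1.
by rewrite -(coeff_symmetrize L_uniq u LA) u0 coeff0.
Qed.

Lemma delta_x_wedge u : delta (fglift (fun A => x_wedge k Q (L A)) u) = 0.
Proof.
rewrite -qproj_x_lifts delta_qproj; apply/qproj_eq0; apply: alt_ker.
by apply/alt_delta_tens => i; rewrite alt_x_lifts delta_x_tens_span.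
Qed.

(** For a representative [v] of [x], [alt v] is a combination [c] of the [x_tens]. As [c] is
    constant on rearrangements, it is the symmetrization of its values [u] at the lists [L A]. So
    [x] and the combination given by [u] have the same alternation and agree by [alt_ker]. *)
Lemma x_wedge_span x : delta x = 0 -> exists u, x = fglift (fun A => x_wedge k Q (L A)) u.
Proof.
have -> : x = qproj (@alt_rel k n p S T) (generic_quotient.repr x).
  by rewrite /qproj generic_quotient.reprK.
move: (generic_quotient.repr x) => v; rewrite delta_qproj => /qproj_eq0/alt_span/alt_delta_tens.
move=> /span_ker[c vc]; have /choice[mono monoP] := L_all.
pose As := undup [seq mono P | P <- dom c].
pose u : {freeg I / k} := \sum_(A <- As) [freeg [:: (coeff (L A) c, A)]].
exists u; rewrite -qproj_x_lifts; apply/subr0_eq; rewrite -linearB.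
apply/qproj_eq0; apply: alt_ker; rewrite linearB /= vc alt_x_lifts.
suff -> : symmetrize L u = c by rewrite subrr.
apply/eqP/freeg_eqP => P; rewrite (coeff_symmetrize L_uniq u (monoP P)).
have cE : coeff (L (mono P)) c = coeff P c.
  by have /permsP[t {2}->] := monoP P; rewrite (coeff_alt_invariant Q_bij _ _ vc).
rewrite /u raddf_sum /=; under eq_bigr do rewrite coeffU.
have [PA|PA] := boolP (mono P \in As).
  rewrite (bigD1_seq (mono P)) ?undup_uniq //= eqxx mulr1 cE big1 ?addr0 // => A ne.
  by rewrite (negPf ne) mulr0.
rewrite big_seq big1 => [|A AAs]; last first.
  by case: eqP => [e|]; [rewrite -e AAs in PA | rewrite mulr0].
apply/esym/coeff_outdom; apply: contra PA => Pc.
by rewrite mem_undup; apply/mapP; exists P.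
Qed.

End ExteriorBasis.

Theorem theorem20 (k : fieldType) (R : realType) (n : nat)
    (Delta Delta' : set 'rV[R]_n)
    (Delta_polytope : lattice_polytope Delta)
    (Delta_dim : exists d : nat, has_dim Delta d /\ (1 < d)%N)
    (Delta'_convex : convex Delta')
    (S T : set 'rV[int]_n)
    (S_def : S = lattice_points Delta') (T_def : T = lattice_points Delta)
    (p : nat) (Q : 'I_p.+1 -> T) (Q_list : bijective Q) :
  is_basis (fun P : {ffun 'I_p -> translates S T} => x_tens k Q P)
    [set v | forall i : 'I_p, delta_at i v = 0]
  /\
  forall L : monomial (translates S T) p -> {ffun 'I_p -> translates S T},
    (forall A, lists (val A) (L A)) ->
    is_basis (fun A : monomial (translates S T) p => x_wedge k Q (L A))
      [set x | delta x = 0].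
Proof.
have span_ker := x_tens_span (k := k) Q_list Delta_polytope Delta_dim Delta'_convex S_def T_def.
split=> [|L L_lists].
  apply: is_basis_fglift => [u|u i|v].
  - exact: x_tens_inj.
  - exact: delta_x_tens_span.
  - exact: span_ker.
have L_uniq A A' P : P \in perms (L A) -> P \in perms (L A') -> A = A'.
  move=> /(perms_lists _ (L_lists A)) AP /(perms_lists _ (L_lists A')) A'P.
  exact/val_inj/(lists_inj AP A'P).
have L_all P : exists A, P \in perms (L A).
  exists (exist _ (monomial_of P) (mdeg_monomial_of P)).
  by apply/(perms_lists _ (L_lists _)); exact: lists_monomial_of.
apply: is_basis_fglift => [u|u|x].
- exact: x_wedge_inj.
- exact: delta_x_wedge.
- exact: x_wedge_span.
Qed.
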